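(* Let $G=(V\cup\{z\},E)$ be a finite graph with sink $z$, let $Q$ be a base chain on $V\cup\{z\}$, and let $\lambda\in(0,\infty)$ be the sleep rate. Let $\pi$ be the stationary distribution of driven-dissipative activated random walk on $G$, and for a configuration $\sigma\in\{\mathfrak s,0,1,\ldots\}^V$ let $\mu(\sigma)$ denote the law of the stabilization of $\sigma$. Let $H$ be the first time at which all walks are at the sink in a system of independent random walks, one started from each vertex of $V$, that all jump simultaneously at time steps $1,2,\ldots$ according to $Q$. Then for any configuration $\sigma$ and any integer $m\ge 1$, $$\bigl\|\mu(\sigma)-\pi\bigr\|_{\mathrm{TV}}\le m\,\mathbf P(\sigma\text{ does not visit all sites})+\mathbf P(H\ge m).$$
   Context: Activated random walk (ARW) on a finite graph $G=(V\cup\{z\},E)$ with sink $z$, sleep rate $\lambda\in(0,\infty)$ and base chain $Q$: here $Q$ is a transition kernel on $V\cup\{z\}$ such that $Q(z,z)=1$, all vertices in $V$ are mutually accessible under $Q$, and $z$ is accessible from $V$ under $Q$. A configuration is an element of $\{\mathfrak s,0,1,2,\ldots\}^V$, where $\mathfrak s$ represents a single sleeping particle and $k\in\{0,1,\ldots\}$ represents $k$ active particles. Each active particle independently jumps at exponential rate $1$, from $v$ to a destination with distribution $Q(v,\cdot)$; an active particle that is alone at its site falls asleep at exponential rate $\lambda$. Sleeping particles do not move, but become active as soon as an active particle moves to their site. Particles reaching the sink are removed forever. Stabilizing a configuration means running these dynamics until no active particles remain (which happens almost surely after finite time); the resulting random configuration in $\{0,\mathfrak s\}^V$ is the stabilization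 of $\sigma$. A configuration $\sigma$ visits all sites if every vertex in $V$ contains an active particle at some point (including the initial time) during the stabilization of $\sigma$. Driven-dissipative chain: given a driving sequence $(u_t)_{t\ge1}$ of vertices in $V$ (deterministic or random, independent of the particle dynamics), at each step $t\ge1$ an active particle is added at $u_t$ to the current configuration (a sleeping particle there becomes active) and the system is then stabilized. This chain on $\{0,\mathfrak s\}^V$ has a unique stationary distribution $\pi$, which does not depend on the driving sequence. $\|\cdot\|_{\mathrm{TV}}$ is the total-variation norm (the distance between probability measures $\mu,\nu$ is $\sup_A|\mu(A)-\nu(A)|$). *)

(* Defs.v *)
From HB Require Import structures.
From mathcomp Require Import all_boot all_order all_algebra.
From mathcomp Require Import all_classical all_reals all_analysis measurable_realfun.

Set Implicit Arguments.
Unset Strict Implicit.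
Unset Printing Implicit Defensive.

Import Order.TTheory GRing.Theory Num.Theory.
Import numFieldNormedType.Exports.

Local Open Scope classical_set_scope.
Local Open Scope ring_scope.

(* The vertex set with sink, V u {z}, is [option V]; the sink is [None]. *)
Definition base_chain (R : realType) (V : finType)
    (Q : option V -> option V -> R) : Prop :=
  [/\ forall x y, 0 <= Q x y,
      forall x, \sum_y Q x y = 1,
      Q None None = 1,
      forall v w : V, connect (fun x y => 0 < Q x y) (Some v) (Some w)
    & forall v : V, connect (fun x y => 0 < Q x y) (Some v) None].

(* [None] is one sleeping particle, [Some k] is k active particles. *)
Definition site : Type := option nat.

Definition nactive (s : site) : nat := if s is Some k then k else 0%N.

Definition add_site (s : site) : site :=
  if s is Some k then Some k.+1 else Some 2%N.

Definition remove_site (s : site) : site :=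
  if s is Some k then Some k.-1 else None.

Definition config (V : finType) : Type := {ffun V -> site}.

Section Configurations.
Context {V : finType}.
Implicit Types (sigma : config V) (v : V).

Definition update (f : site -> site) sigma v : config V :=
  [ffun u => if u == v then f (sigma u) else sigma u].

Definition add_active sigma v : config V := update add_site sigma v.

Definition jump sigma v (x : option V) : config V :=
  let sigma' := update remove_site sigma v in
  if x is Some w then add_active sigma' w else sigma'.

Definition fall_asleep sigma v : config V := update (fun=> None) sigma v.

End Configurations.

(* {0, s}^V; the value [true] is a sleeping particle. *)
Definition sconfig (V : finType) : Type := {ffun V -> bool}.

Definition to_config (V : finType) (eta : sconfig V) : config V :=
  [ffun v => if eta v then None else Some 0%N].

Section Rates.
Context {R : realType} {V : finType}.
Variables (Q : option V -> option V -> R) (lambda : R).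

(* Total rate of the events (jumps and falling asleep) taking sigma into A. *)
Definition rate (sigma : config V) (A : pred (config V)) : R :=
  \sum_(v : V) (nactive (sigma v))%:R *
     (\sum_(x : option V | A (jump sigma v x)) Q (Some v) x)
  + \sum_(v : V | (sigma v == Some 1%N) && A (fall_asleep sigma v)) lambda.

(* A particle may jump back to its own site, which is not a transition of the
   configuration; hence the target sigma is excluded. *)
Definition exit_rate (sigma : config V) : R := rate sigma (predC1 sigma).

Definition jump_prob (sigma tau : config V) : R :=
  if exit_rate sigma == 0 then (tau == sigma)%:R
  else if tau == sigma then 0
  else rate sigma (pred1 tau) / exit_rate sigma.

End Rates.

(* The continuous-time Markov chain with the above rates, as a Markov family
   (P_sigma)_sigma on one measurable space, given by the sequence of successive
   states and the holding times in them. In a configuration with exit rate 0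
   the chain is absorbed: the holding time is +oo and, by convention, the
   sequence of states is constant from there on. *)
Record ARW (R : realType) (V : finType)
    (Q : option V -> option V -> R) (lambda : R) := {
  arw_display : measure_display;
  arw_space : measurableType arw_display;
  arw_prob : config V -> probability arw_space R;
  arw_state : nat -> arw_space -> config V;
  arw_hold : nat -> arw_space -> \bar R;
  arw_state_measurable : forall n (tau : config V),
    measurable [set omega | arw_state n omega = tau];
  arw_hold_measurable : forall n, measurable_fun setT (arw_hold n);
  arw_hold_gt0 : forall n omega, (0 < arw_hold n omega)%E;
  arw_law : forall (sigma : config V) (n : nat) (s : nat -> config V)
      (t : nat -> R), (forall k, 0 <= t k) ->
    arw_prob sigma
      [set omega | (forall k, (k <= n)%N -> arw_state k omega = s k) /\
                   (forall k, (k < n)%N -> ((t k)%:E < arw_hold k omega)%E)] =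
    ((s 0%N == sigma)%:R *
       \prod_(k < n) (expR (- (exit_rate Q lambda (s k) * t k)) *
                      jump_prob Q lambda (s k) (s k.+1)))%:E }.

Section Stabilization.
Context {R : realType} {V : finType} {Q : option V -> option V -> R}.
Context {lambda : R} (X : ARW Q lambda).
Implicit Types (sigma : config V) (omega : arw_space X).

(* The configuration at time t is tau. *)
Definition at_time (t : R) omega (tau : config V) : Prop :=
  exists n : nat, [/\ arw_state n omega = tau,
    (\sum_(k < n) arw_hold k omega <= t%:E)%E &
    (t%:E < \sum_(k < n.+1) arw_hold k omega)%E].

Definition stabilizes_to (eta : sconfig V) : set (arw_space X) :=
  [set omega | exists t : R, at_time t omega (to_config eta)].

Definition visits_all : set (arw_space X) :=
  [set omega | forall v : V, exists (t : R) (tau : config V),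
     at_time t omega tau /\ (0 < nactive (tau v))%N].

Definition stab_law sigma (eta : sconfig V) : R :=
  fine (arw_prob X sigma (stabilizes_to eta)).

(* One step of the driven-dissipative chain with driving vertex v, acting on
   the right of mass functions. *)
Definition driven_step (nu : sconfig V -> R) (v : V) : sconfig V -> R :=
  fun xi => \sum_(eta : sconfig V)
    nu eta * stab_law (add_active (to_config eta) v) xi.

End Stabilization.

Arguments visits_all {R V Q lambda} X _.

(* A random driving sequence; u_(t+1) is [driving_vertex t]. Deterministic
   sequences are the constant ones in omega. *)
Record driving (R : realType) (V : finType) := {
  driving_display : measure_display;
  driving_space : measurableType driving_display;
  driving_prob : probability driving_space R;
  driving_vertex : nat -> driving_space -> V;
  driving_measurable : forall t (v : V),
    measurable [set omega | driving_vertex t omega = v] }.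

Section DrivenDissipative.
Context {R : realType} {V : finType} {Q : option V -> option V -> R}.
Context {lambda : R} (X : ARW Q lambda) (u : driving R V).

(* Law at time t of the chain started from pi, the initial configuration and
   the particle dynamics being independent of u: average over (u_1, .., u_t). *)
Definition driven_law (pi : sconfig V -> R) (t : nat) : sconfig V -> R :=
  fun xi => \sum_(us : t.-tuple V)
    fine (driving_prob u
      [set omega : driving_space u |
        forall i : 'I_t, driving_vertex i omega = tnth us i]) *
    foldl (driven_step X) pi us xi.

Definition stationary_distribution (pi : sconfig V -> R) : Prop :=
  [/\ forall eta, 0 <= pi eta,
      \sum_eta pi eta = 1
    & forall t xi, driven_law pi t xi = pi xi].

End DrivenDissipative.

Definition tv_dist (R : realType) (T : finType) (mu nu : T -> R) : R :=
  sup (range (fun A : {set T} =>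
    `| \sum_(x in A) mu x - \sum_(x in A) nu x |)).

(* Independent walks, one from each vertex; independence is the product over v
   in the joint law of the trajectories. *)
Record walks (R : realType) (V : finType) (Q : option V -> option V -> R) := {
  walks_display : measure_display;
  walks_space : measurableType walks_display;
  walks_prob : probability walks_space R;
  walks_pos : nat -> V -> walks_space -> option V;
  walks_measurable : forall n v (x : option V),
    measurable [set omega | walks_pos n v omega = x];
  walks_law : forall (n : nat) (w : nat -> V -> option V),
    walks_prob
      [set omega | forall k, (k <= n)%N -> forall v,
                     walks_pos k v omega = w k v] =
    (\prod_(v : V) ((w 0%N v == Some v)%:R *
       \prod_(k < n) Q (w k v) (w k.+1 v)))%:E }.

(* The time H, equal to +oo if the walks are never all at the sink. *)
Definition hitting_time (R : realType) (V : finType)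
    (Q : option V -> option V -> R) (W : walks Q)
    (omega : walks_space W) : \bar R :=
  ereal_inf [set n%:R%:E | n in
    [set n : nat | forall v : V, walks_pos n v omega = None]].

(* Main.v *)
Require Import Defs.
From mathcomp Require Import all_boot all_order all_algebra.
From mathcomp Require Import all_classical all_reals all_analysis measurable_realfun.
From mathcomp Require Import zify ring lra.

Import Order.TTheory GRing.Theory Num.Theory.
Import numFieldNormedType.Exports.
Local Open Scope classical_set_scope.
Local Open Scope ring_scope.

Set Implicit Arguments.
Unset Strict Implicit.
Unset Printing Implicit Defensive.

(** Abelian property: the law of the stabilization does not change when an
    active site is first toppled by a random instruction (sleep with probability
    lambda / (1 + lambda), having no effect unless the particle is alone, and
    jump otherwise).  Hence if one active particle per site is added to any
    sigma, the stabilization has a law that does not depend on sigma; as the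
    number of driving particles grows this law is also the limit of the driven
    chain, so it is pi.

    To compare it with mu(sigma), keep the added particles frozen while sigma
    evolves, and let those at v jump once when sigma first has an active particle
    at v: at this time v carries two active particles, so the jump is a legal
    toppling.  If sigma visits all sites, every added particle has jumped once,
    independently of the rest.  So replacing the added particles by their
    positions after one more jump costs P(sigma does not visit all sites) in
    total variation, and after m - 1 jumps none is left, except with probability
    P(H >= m).

    Termination of the dynamics, and with it every uniqueness statement, comes
    from an energy: with pot >= 0 and Q pot <= pot - 1 off the sink, the sum of
    pot over the particles decreases in mean by at least 1 / (1 + lambda) at each
    toppling. *)

(** * Instructions and added particles *)

(** The energy arguments bound n times an error by an expression free of n; this turns such a bound
    into a vanishing error. *)
Lemma le0_of_natmul_bounded (R : realType) (x y : R) :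
  (forall n : nat, n%:R * x <= y) -> x <= 0.
Proof.
move=> H; rewrite leNgt; apply/negP => x0.
have y0 : 0 <= y by have := H 0%N; rewrite mul0r.
have := archi_boundP (divr_ge0 y0 (ltW x0)).
by rewrite ltr_pdivrMr // ltNge H.
Qed.

Section Instructions.
Context {V : finType}.
Implicit Types (sigma : config V) (v w : V) (tau : {ffun V -> nat}).

Definition active sigma v : bool := (0 < nactive (sigma v))%N.

Definition stable sigma : bool := [forall v, ~~ active sigma v].

Definition sleep sigma v : config V :=
  update (fun s => if s == Some 1%N then None else s) sigma v.

(* [None] is the sleep instruction, which has no effect unless the particle is
   alone; this makes instructions at distinct sites commute. *)
Definition op sigma v (i : option (option V)) : config V :=
  if i is Some x then jump sigma v x else sleep sigma v.

(** An instruction acts first at the toppled site, then at its destination; with this splitting,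
    identities can be checked site by site, including for a jump from a site to itself. *)
Definition op_site (i : option (option V)) (s : site) : site :=
  if i is Some _ then remove_site s else if s == Some 1%N then None else s.

Definition op_add (i : option (option V)) (u : V) (s : site) : site :=
  if i == Some (Some u) then add_site s else s.

Lemma opE sigma v i u :
  op sigma v i u =
    op_add i u (if u == v then op_site i (sigma u) else sigma u).
Proof.
rewrite /op /op_add /op_site; case: i => [[w|]|] //=.
- rewrite /jump /add_active !ffunE.
  have [->|uw] := eqVneq u w; first by rewrite eqxx.
  by case: (_ =P Some (Some u)) uw => // -[->]; rewrite eqxx.
- by rewrite !ffunE.
- by rewrite ffunE.
Qed.

Lemma active_op sigma v w i : v != w -> active sigma w -> active (op sigma v i) w.
Proof.
move=> vw; rewrite /active opE eq_sym (negbTE vw) /op_add.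
by case: eqP => // _; case: (sigma w).
Qed.

(** A lone particle that falls asleep and is then woken by an arrival gives the same two active
    particles as an arrival that makes the sleep instruction void. *)
Lemma op_comm sigma v w i j : v != w -> active sigma v -> active sigma w ->
  op (op sigma v i) w j = op (op sigma w j) v i.
Proof.
move=> vw av aw; apply/ffunP => u; rewrite !opE.
have [uv|uv] := eqVneq u v.
  rewrite uv (negbTE vw) /op_add.
  move: av; rewrite /active; case: (sigma v) => //= -[|[|k]] // _.
    by case: eqP => // _; case: eqP => //=; case: i => //= ? _; case: eqP.
  by case: eqP => // _; case: eqP => //=; case: i => //= ? _; case: eqP.
have [uw|uw] := eqVneq u w.
  rewrite uw /op_add.
  move: aw; rewrite /active; case: (sigma w) => //= -[|[|k]] // _.
    by case: eqP => // _; case: eqP => //=; case: j => //= ? _; case: eqP.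
  by case: eqP => // _; case: eqP => //=; case: j => //= ? _; case: eqP.
by rewrite /op_add; case: eqP => // _; case: eqP.
Qed.

Definition npart (s : site) : nat := if s is Some k then k else 1%N.

(** Added active particles wake a sleeping one, but adding none must leave it asleep, hence the case
    distinction. *)
Definition join_site (s : site) (k : nat) : site :=
  if k is 0 then s else Some (npart s + k)%N.

Definition join sigma tau : config V := [ffun v => join_site (sigma v) (tau v)].

Lemma join0 sigma : join sigma [ffun=> 0%N] = sigma.
Proof. by apply/ffunP => v; rewrite !ffunE. Qed.

Lemma join_joinE sigma tau tau' :
  join (join sigma tau) tau' = join sigma [ffun v => (tau v + tau' v)%N].
Proof.
apply/ffunP => v; rewrite !ffunE /join_site.
case: (tau v) (tau' v) => [|k] [|l] //=; first by rewrite addn0.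
by rewrite addnA.
Qed.

Lemma add_active_join sigma v :
  add_active sigma v = join sigma [ffun w => (w == v : nat)].
Proof.
apply/ffunP => w; rewrite !ffunE /join_site; case: eqP => // _.
by case: (sigma w) => //= k; rewrite addn1.
Qed.

Lemma active_join sigma tau v : active sigma v -> active (join sigma tau) v.
Proof.
rewrite /active ffunE /join_site; case: (tau v) => //= k.
by case: (sigma v) => //= l; lia.
Qed.

(** Added particles can be kept frozen: if the instruction puts a lone particle of [sigma] to sleep,
    adding them wakes it again, and if they are already there the sleep instruction is void. *)
Lemma op_join sigma tau v i : active sigma v ->
  op (join sigma tau) v i = join (op sigma v i) tau.
Proof.
move=> av; apply/ffunP => u; rewrite opE !ffunE opE.
rewrite /op_add /join_site.
case: (u =P v) => [->|_].
  move: av; rewrite /active; case: (sigma v) => //= -[|[|k]] // _.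
    case: i => [x|] /=.
      by case: eqP => // _; case: (tau v) => //= ?; rewrite ?add0n ?add1n.
    by case: (tau v).
  case: i => [x|] /=.
    by case: eqP => // _; case: (tau v) => //= ?.
  by case: (tau v).
case: eqP => // _; case: (tau u) => //= k; case: (sigma u) => //= l.
Qed.

Lemma stable_to_config (eta : sconfig V) : stable (to_config eta).
Proof. by apply/forallP => v; rewrite /active ffunE; case: (eta v). Qed.

Lemma to_config_inj : injective (@to_config V).
Proof.
move=> a b /ffunP ab; apply/ffunP => v; have := ab v.
by rewrite !ffunE; case: (a v); case: (b v).
Qed.

Lemma stableE sigma : stable sigma -> exists eta, sigma = to_config eta.
Proof.
move=> /forallP st; exists [ffun v => sigma v == None]; apply/ffunP => v.
by rewrite !ffunE; have := st v; rewrite /active; case: (sigma v) => // -[].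
Qed.

Lemma unstableP sigma : ~~ stable sigma -> exists v, active sigma v.
Proof. by move/forallPn => [v]; rewrite negbK => av; exists v. Qed.

End Instructions.

(** * Toppling, energy and the abelian property *)

Lemma sum_option (R : realType) (T : finType) (F : option T -> R) :
  \sum_i F i = F None + \sum_x F (Some x).
Proof.
rewrite (bigD1 None) //=; congr (_ + _).
rewrite (reindex_omap Some id) /=; first by apply: eq_bigl => x; rewrite eqxx.
by case.
Qed.

Section Toppling.
Context {R : realType} {V : finType} (Q : option V -> option V -> R).
Context (hQ : base_chain Q) (lambda : R) (hlambda : 0 < lambda).
Implicit Types (sigma : config V) (v w : V) (f g : config V -> R).

Definition instr_prob v (i : option (option V)) : R :=
  (if i is Some x then Q (Some v) x else lambda) / (1 + lambda).

Definition topple f sigma v : R :=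
  \sum_i instr_prob v i * f (op sigma v i).

Lemma toppleE f sigma v : topple f sigma v =
  (lambda * f (op sigma v None) + \sum_x Q (Some v) x * f (jump sigma v x)) / (1 + lambda).
Proof.
rewrite /topple sum_option mulrDl mulrAC; congr (_ + _).
by rewrite mulr_suml; apply: eq_bigr => x _; rewrite mulrAC.
Qed.

Lemma lambda1_gt0 : 0 < 1 + lambda.
Proof. by rewrite addr_gt0. Qed.

Lemma base_chain_ge0 x y : 0 <= Q x y.
Proof. by case: hQ. Qed.

Lemma base_chain_sum x : \sum_y Q x y = 1.
Proof. by case: hQ. Qed.

Lemma base_chain_sink y : Q None y = (y == None)%:R.
Proof.
have [Q0 Q1 Qs _ _] := hQ.
case: eqP => [->|/eqP yN] //; apply/eqP; rewrite eq_le Q0 andbT.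
have := Q1 None; rewrite (bigD1 None) //= (bigD1 y) //= Qs => H.
have : 0 <= \sum_(i | (i != None) && (i != y)) Q None i by apply: sumr_ge0.
by move: H; lra.
Qed.

Lemma instr_prob_ge0 v i : 0 <= instr_prob v i.
Proof.
rewrite divr_ge0 ?(ltW lambda1_gt0) //.
by case: i => [x|]; [exact: base_chain_ge0 | exact: ltW].
Qed.

Lemma sum_instr_prob v : \sum_i instr_prob v i = 1.
Proof.
rewrite -mulr_suml sum_option base_chain_sum addrC divff //.
by rewrite gt_eqF ?lambda1_gt0.
Qed.

Lemma le_topple f g sigma v : (forall i, f (op sigma v i) <= g (op sigma v i)) ->
  topple f sigma v <= topple g sigma v.
Proof. by move=> fg; apply: ler_sum => i _; rewrite ler_wpM2l ?instr_prob_ge0. Qed.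

Lemma topple_cst c sigma v : topple (fun=> c) sigma v = c.
Proof. by rewrite /topple -mulr_suml sum_instr_prob mul1r. Qed.

Lemma topple_bound f sigma v c : (forall i, f (op sigma v i) <= c) ->
  topple f sigma v <= c.
Proof. by move=> fc; rewrite -[leRHS](topple_cst c sigma v); exact: le_topple. Qed.

Lemma topple_ge0 f sigma v : (forall i, 0 <= f (op sigma v i)) ->
  0 <= topple f sigma v.
Proof. by move=> f0; rewrite sumr_ge0 // => i _; rewrite mulr_ge0 ?instr_prob_ge0. Qed.

Lemma toppleB f g sigma v :
  topple (fun s => f s - g s) sigma v = topple f sigma v - topple g sigma v.
Proof. by rewrite /topple -sumrB; apply: eq_bigr => i _; rewrite mulrBr. Qed.

Lemma toppleZ c f sigma v :
  topple (fun s => c * f s) sigma v = c * topple f sigma v.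
Proof. by rewrite /topple mulr_sumr; apply: eq_bigr => i _; rewrite mulrCA. Qed.

Lemma topple_sum (I : finType) (P : pred I) (F : I -> config V -> R) sigma v :
  topple (fun s => \sum_(i | P i) F i s) sigma v
  = \sum_(i | P i) topple (F i) sigma v.
Proof.
rewrite /topple exchange_big /=; apply: eq_bigr => i _.
by rewrite mulr_sumr.
Qed.

Lemma ler_norm_topple f sigma v :
  `|topple f sigma v| <= topple (fun s => `|f s|) sigma v.
Proof.
apply: le_trans (ler_norm_sum _ _ _) _; apply: ler_sum => i _.
by rewrite normrM ger0_norm ?instr_prob_ge0.
Qed.

Lemma topple_comm f sigma v w : v != w -> active sigma v -> active sigma w ->
  topple (fun s => topple f s w) sigma v = topple (fun s => topple f s v) sigma w.
Proof.
move=> vw av aw; rewrite /topple.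
under eq_bigr do rewrite mulr_sumr; under [RHS]eq_bigr do rewrite mulr_sumr.
rewrite exchange_big; apply: eq_bigr => j _; apply: eq_bigr => i _.
by rewrite op_comm // mulrCA.
Qed.

(* Abelian property in law: whichever active site is toppled first, the
   expectation of f after the toppling is the same. *)
Definition topple_invariant f : Prop :=
  forall sigma v, active sigma v -> f sigma = topple f sigma v.

Lemma invariant_cst c : topple_invariant (fun=> c).
Proof. by move=> s v _; rewrite topple_cst. Qed.

Lemma invariantB f g : topple_invariant f -> topple_invariant g ->
  topple_invariant (fun s => f s - g s).
Proof. by move=> hf hg s v av; rewrite toppleB -hf // -hg. Qed.

Lemma invariantZ c f : topple_invariant f -> topple_invariant (fun s => c * f s).
Proof. by move=> hf s v av; rewrite toppleZ -hf. Qed.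

Lemma invariant_sum (I : finType) (P : pred I) (F : I -> config V -> R) :
  (forall i, topple_invariant (F i)) -> topple_invariant (fun s => \sum_(i | P i) F i s).
Proof.
by move=> hF s v av; rewrite topple_sum; apply: eq_bigr => i _; exact: hF.
Qed.

Lemma invariant_join f tau : topple_invariant f -> topple_invariant (fun s => f (join s tau)).
Proof.
move=> hf s v av; rewrite (hf _ v (active_join tau av)) /topple.
by apply: eq_bigr => i _; rewrite op_join.
Qed.

(** With two active particles the sleep instruction is void, so its term can be removed from the
    invariance equation, leaving the average over jumps. *)
Lemma invariant_jump f sigma v : topple_invariant f -> (1 < nactive (sigma v))%N ->
  f sigma = \sum_x Q (Some v) x * f (jump sigma v x).
Proof.
move=> hf kv; have av : active sigma v by exact: ltnW.
have opN : op sigma v None = sigma.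
  apply/ffunP => u; rewrite opE /op_add /op_site /=; case: (u =P v) => [->|//].
  by move: kv; case: (sigma v) => [[|[]]|].
have := hf _ _ av; rewrite toppleE opN; have l0 := lambda1_gt0.
move: (\sum_x _) (f sigma) => S y /(congr1 ( *%R^~ (1 + lambda))).
by rewrite mulfVK ?gt_eqF //; lra.
Qed.

(** A Lyapunov function for the base chain. The expected number of steps to the sink is an instance,
    but the inequality allows an explicit choice. *)
Definition is_potential (pot : option V -> R) : Prop :=
  [/\ pot None = 0, forall x, 0 <= pot x &
      forall v, \sum_x Q (Some v) x * pot x <= pot (Some v) - 1].

(* With d the distance to the sink, C (1 - eps ^ d) is a potential: some jump
   from v has probability at least 2 eps and lowers d, and eps ^ d >= 0 makes
   the other destinations irrelevant. *)
Lemma exists_potential : exists pot, is_potential pot.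
Proof.
have [Q0 Q1 Qs _ Qsink] := hQ.
pose e : rel (option V) := fun x y => 0 < Q x y.
have path_sink x : exists n,
    [exists p : n.-tuple (option V), path e x p && (last x p == None)].
  have : connect e x None by case: x => [v|] //; exact: Qsink.
  case/connectP => p ep lp; exists (size p); apply/existsP; exists (in_tuple p).
  by rewrite /= ep -lp eqxx.
pose d x := ex_minn (path_sink x).
have dN : d None = 0%N.
  rewrite /d; case: ex_minnP => n _ /(_ 0%N).
  by case: n => // n /(_ _)/wrap[]//; apply/existsP; exists [tuple] => /=.
have step v : exists y, (0 < Q (Some v) y) && (d y < d (Some v))%N.
  rewrite {2}/d; case: ex_minnP => n /existsP[[p /= /eqP sp]] /andP[ep lp] _.
  case: p sp ep lp => [|y p] //= sp /andP[evy ep] lp.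
  exists y; rewrite -/(e _ _) evy -sp ltnS /d /=; case: ex_minnP => k _; apply.
  by apply/existsP; exists (in_tuple p); rewrite ep lp.
pose q v := Q (Some v) (xchoose (step v)).
pose eps : R := (\big[Order.min/1]_v q v) / 2.
have q_gt0 v : 0 < q v by have /andP[] := xchooseP (step v).
have min_gt0 : 0 < \big[Order.min/1]_v q v.
  by apply: (big_ind (fun x => 0 < x)) => // x y x0 y0; rewrite lt_min x0.
have eps_gt0 : 0 < eps by rewrite divr_gt0.
have min_le v : \big[Order.min/1]_v q v <= q v by exact: bigmin_le_cond.
have min_le1 : \big[Order.min/1]_v q v <= 1 by exact: bigmin_le_id.
have eps_le1 : eps <= 1 by rewrite /eps; lra.
have eps_le v : 2 * eps <= q v by have := min_le v; rewrite /eps; lra.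
(* This makes [C * eps ^+ d (Some v)] at least 1 for every v, which gives the required drop by 1. *)
pose C : R := \sum_v eps ^- d (Some v).
exists (fun x => C * (1 - eps ^+ d x)); split.
- by rewrite dN expr0 subrr mulr0.
- move=> x; rewrite mulr_ge0 // ?subr_ge0 ?exprn_ile1 ?(ltW eps_gt0) //.
  by rewrite sumr_ge0 // => v _; rewrite invr_ge0 exprn_ge0 ?ltW.
- move=> v.
  have -> : \sum_x Q (Some v) x * (C * (1 - eps ^+ d x)) =
            C * (1 - \sum_x Q (Some v) x * eps ^+ d x).
    under eq_bigr do rewrite mulrCA mulrBr mulr1.
    by rewrite -mulr_sumr sumrB Q1.
  set S := \sum_x _.
  have HS : 2 * eps ^+ d (Some v) <= S.
    have /andP[_ hd] := xchooseP (step v).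
    rewrite /S (bigD1 (xchoose (step v))) //=.
    apply: (@le_trans _ _ (q v * eps ^+ d (xchoose (step v)))); last first.
      rewrite lerDl sumr_ge0 // => x _.
      by rewrite mulr_ge0 // exprn_ge0 // ltW.
    suff pow_le n k : (n < k)%N -> 2 * eps ^+ k <= q v * eps ^+ n by exact: pow_le.
    case: k => // k nk; rewrite exprS mulrA.
    have e0 := ltW eps_gt0.
    apply: ler_pM; [by rewrite mulr_ge0 | by rewrite exprn_ge0 | exact: eps_le |].
    by rewrite ler_wiXn2l.
  have C0 : 1 <= C * eps ^+ d (Some v).
    rewrite -ler_pdivrMr ?exprn_gt0 // mul1r /C (bigD1 v) //= lerDl.
    by rewrite sumr_ge0 // => w _; rewrite invr_ge0 exprn_ge0 ?ltW.
  have C1 : 0 <= C by rewrite sumr_ge0 // => w _; rewrite invr_ge0 exprn_ge0 ?ltW.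
  have := ler_wpM2l C1 HS; rewrite mulrCA !mulrBr; lra.
Qed.

(** Sleeping particles count as well, so that falling asleep and waking up leave the energy
    unchanged. *)
Definition energy (pot : option V -> R) sigma : R :=
  \sum_v (npart (sigma v))%:R * pot (Some v).

Lemma energy_ge0 pot sigma : is_potential pot -> 0 <= energy pot sigma.
Proof. by case=> _ pot0 _; rewrite sumr_ge0 // => v _; rewrite mulr_ge0. Qed.

Lemma energy_sleep pot sigma v : energy pot (op sigma v None) = energy pot sigma.
Proof.
apply: eq_bigr => u _; congr (_%:R * _); rewrite opE /op_add /op_site /=.
by case: (u =P v) => // _; case: (sigma u) => // -[|[]].
Qed.

Lemma energy_jump pot sigma v x : pot None = 0 -> active sigma v ->
  energy pot (op sigma v (Some x)) = energy pot sigma - pot (Some v) + pot x.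
Proof.
move=> potN av; rewrite /energy.
have -> : pot (Some v) = \sum_u (u == v)%:R * pot (Some u).
  rewrite (bigD1 v) //= eqxx mul1r big1 ?addr0 // => u /negbTE ->.
  by rewrite mul0r.
have -> : pot x = \sum_u (x == Some u)%:R * pot (Some u).
  case: x => [w|].
    rewrite (bigD1 w) //= eqxx mul1r big1 ?addr0 // => u uw.
    by case: (Some w =P Some u) uw => [[->]|_ _]; rewrite ?eqxx ?mul0r.
  by rewrite potN big1 // => u _; rewrite mul0r.
rewrite -sumrB -big_split /=; apply: eq_bigr => u _.
rewrite -mulrBl -mulrDl; congr (_ * _).
suff /(congr1 (fun k => k%:R : R)) : (npart (op sigma v (Some x) u) + (u == v) =
    npart (sigma u) + (x == Some u))%N by rewrite !natrD => H; lra.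
rewrite opE /op_add /op_site (inj_eq (@Some_inj _)).
case: (u =P v) => [->|_].
  move: av; rewrite /active; case: (sigma v) => //= -[|k] // _.
  by case: eqP => _ /=; rewrite ?addn0 ?addn1.
case: eqP => // _; case: (sigma u) => [k|] /=; by rewrite ?addn0 ?addn1.
Qed.

Lemma sum_jump_energy pot sigma v : is_potential pot -> active sigma v ->
  \sum_x Q (Some v) x * energy pot (op sigma v (Some x)) <= energy pot sigma - 1.
Proof.
move=> [potN pot0 potQ] av; under eq_bigr do rewrite energy_jump // mulrDr.
rewrite big_split /= -mulr_suml base_chain_sum mul1r.
by have := potQ v; lra.
Qed.

(** Only jumps, of total probability [(1 + lambda)^-1], lower the energy. *)
Lemma topple_energy pot sigma v : is_potential pot -> active sigma v ->
  topple (energy pot) sigma v <= energy pot sigma - (1 + lambda)^-1.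
Proof.
move=> hpot av; move: (sum_jump_energy hpot av); rewrite toppleE energy_sleep.
move: (\sum_x _) (energy _ _) => S E H; have l0 := lambda1_gt0.
by rewrite ler_pdivrMr // mulrBl mulVf ?gt_eqF //; lra.
Qed.

(* Each toppling lowers the expected energy by 1 / (1 + lambda), so that the
   energy bounds the expected number of topplings before the alternative
   [D sigma <= 0] is met; hence [n D <= (1 + lambda) energy] for all n. *)
Lemma descent (P : config V -> Prop) (D : config V -> R) (c : R) :
  (forall sigma, P sigma -> D sigma <= c) ->
  (forall sigma, P sigma -> D sigma <= 0 \/ exists2 v, active sigma v &
     D sigma <= topple D sigma v /\ forall i, P (op sigma v i)) ->
  forall sigma, P sigma -> D sigma <= 0.
Proof.
move=> Dc HD sigma Ps; have [pot hpot] := exists_potential.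
have pot0 s := energy_ge0 s hpot.
wlog c0 : c Dc / 0 < c.
  move=> H; apply: (H (Num.max c 1)); last by rewrite lt_max ltr01 orbT.
  by move=> s /Dc Ds; rewrite le_max Ds.
have l0 := lambda1_gt0.
apply: (@le0_of_natmul_bounded _ _ (c * (1 + lambda) * energy pot sigma)) => n.
elim: n sigma Ps => [|n IH] sigma Ps.
  by rewrite mul0r mulr_ge0 // mulr_ge0 // ltW.
have [D0|[v av [DT PT]]] := HD _ Ps.
  apply: (@le_trans _ _ 0); first by rewrite mulr_ge0_le0.
  by rewrite mulr_ge0 // mulr_ge0 // ltW.
rewrite -natr1 mulrDl mul1r.
have H1 : n%:R * topple D sigma v <= c * (1 + lambda) * topple (energy pot) sigma v.
  rewrite -!toppleZ; apply: ler_sum => i _.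
  by rewrite ler_wpM2l ?instr_prob_ge0 // IH.
have H2 := topple_energy hpot av.
have H3 : c * (1 + lambda) * topple (energy pot) sigma v <=
    c * (1 + lambda) * energy pot sigma - c.
  apply: le_trans (ler_wpM2l _ H2) _; first by rewrite mulr_ge0 // ltW.
  by rewrite mulrBr mulfK ?gt_eqF.
have H4 : n%:R * D sigma <= n%:R * topple D sigma v by rewrite ler_wpM2l.
by have := Dc _ Ps; lra.
Qed.

(** [|f - g|] is at most its average after a toppling and vanishes at stable configurations, so
    [descent] forces it to be 0. *)
Lemma invariant_unique f g c : topple_invariant f -> topple_invariant g ->
  (forall sigma, `|f sigma - g sigma| <= c) ->
  (forall eta, f (to_config eta) = g (to_config eta)) -> f =1 g.
Proof.
move=> hf hg hc fg sigma; apply/eqP; rewrite -subr_eq0 -normr_le0.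
apply: (@descent (fun=> True) (fun s => `|f s - g s|) c) => // s _.
have [/stableE[eta ->]|/unstableP[v av]] := boolP (stable s).
  by left; rewrite fg subrr normr0.
right; exists v => //; split=> //.
by rewrite (invariantB hf hg av) ler_norm_topple.
Qed.

(** * Existence of invariant functions, by optimal toppling *)

Section StabilizationFunction.
Context (xi : sconfig V).

(* Optimal probability, over all toppling strategies, of reaching xi within n
   topplings. *)
Fixpoint best (n : nat) sigma : R :=
  if n isn't n'.+1 then (sigma == to_config xi)%:R
  else if stable sigma then (sigma == to_config xi)%:R
  else \big[Order.max/0]_(v | active sigma v) topple (best n') sigma v.

Lemma best_stable n sigma : stable sigma -> best n sigma = (sigma == to_config xi)%:R.
Proof. by case: n => //= n ->. Qed.

Lemma topple_best_le n sigma v : active sigma v ->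
  topple (best n) sigma v <= best n.+1 sigma.
Proof.
move=> av /=; case: ifPn => [/forallP/(_ v)|_]; first by rewrite av.
exact: (le_bigmax_cond _ (fun v => topple (best n) sigma v)).
Qed.

Lemma best_ge0 n sigma : 0 <= best n sigma.
Proof.
case: n => //= n; case: ifP => // _.
by apply: bigmax_ge_id.
Qed.

Lemma best_le1 n sigma : best n sigma <= 1.
Proof.
elim: n sigma => [|n IH] sigma /=; first by case: eqP.
case: ifP => _; first by case: eqP.
by apply/bigmax_leP; split => // v av; exact: topple_bound.
Qed.

Lemma best_nondecreasing n sigma : best n sigma <= best n.+1 sigma.
Proof.
elim: n sigma => [|n IH] sigma.
  have [/best_stable b|st] := boolP (stable sigma); first by rewrite !b.
  have -> : best 0 sigma = 0.
    by rewrite /=; case: eqP st => // ->; rewrite stable_to_config.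
  exact: best_ge0.
rewrite [leLHS]/=; case: ifPn => st; first by rewrite best_stable.
apply/bigmax_leP; split => [|v av]; first exact: best_ge0.
by apply: le_trans (topple_best_le _ av); exact: le_topple.
Qed.

(** The first toppling can be prescribed at no loss: by [topple_comm] an optimal first toppling at w
    is exchanged with the one at v, and induction applies to the rest. Here commutation yields the
    abelian property. *)
Lemma best_le_topple n sigma v : active sigma v ->
  best n sigma <= topple (best n) sigma v.
Proof.
elim: n sigma v => [|n IH] sigma v av.
  rewrite /=; case: eqP => [s_xi|_]; last first.
    by apply: topple_ge0.
  by have /forallP/(_ v) := stable_to_config xi; rewrite -s_xi av.
rewrite [leLHS]/=; case: ifPn => [/forallP/(_ v)|_]; first by rewrite av.
apply/bigmax_leP; split => [|w aw].
  by apply: topple_ge0 => i; exact: best_ge0.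
have [->|vw] := eqVneq w v.
  by apply: le_topple => i; exact: best_nondecreasing.
apply: (@le_trans _ _ (topple (fun s => topple (best n) s v) sigma w)).
  by apply: le_topple => i; apply: IH; exact: active_op.
rewrite topple_comm //; apply: le_topple => i; apply: topple_best_le.
by apply: active_op => //; rewrite eq_sym.
Qed.

(** The increasing limit of [best n] is invariant: at every active site [topple (best n)] lies
    between [best n] and [best n.+1]. *)
Lemma exists_invariant : exists a, [/\ topple_invariant a,
  forall sigma, 0 <= a sigma <= 1 & forall eta, a (to_config eta) = (eta == xi)%:R].
Proof.
have cvg_best sigma : cvgn (fun n => best n sigma).
  apply: nondecreasing_is_cvgn.
    by apply/nondecreasing_seqP => n; exact: best_nondecreasing.
  by exists 1 => _ [n _ <-]; exact: best_le1.
pose a sigma : R := limn (fun n => best n sigma); exists a.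
have cvg_topple sigma v : topple (best n) sigma v @[n --> \oo] --> topple a sigma v.
  rewrite /topple; apply: cvg_big => //; first exact: add_continuous.
  by move=> i _; apply: cvgM; [exact: cvg_cst | exact: cvg_best].
split.
- move=> sigma v av; apply/eqP; rewrite eq_le; apply/andP; split.
    apply: (ler_cvg_to (cvg_best sigma) (cvg_topple sigma v)).
    by near=> n; exact: best_le_topple.
  have cvg_bestS : best n.+1 sigma @[n --> \oo] --> a sigma.
    by rewrite (cvg_shiftS (fun n => best n sigma)); exact: cvg_best.
  apply: (ler_cvg_to (cvg_topple sigma v) cvg_bestS).
  by near=> n; exact: topple_best_le.
- move=> sigma; apply/andP; split.
    by apply: limr_ge (cvg_best sigma) _; near=> n; exact: best_ge0.
  by apply: limr_le (cvg_best sigma) _; near=> n; exact: best_le1.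
- move=> eta; rewrite /a.
  under eq_fun do rewrite best_stable ?stable_to_config //.
  by rewrite lim_cst // (inj_eq (@to_config_inj _)).
Unshelve. all: by end_near. Qed.

End StabilizationFunction.

End Toppling.

(** * The law of the stabilization *)

Section StabilizationFamily.
Context {R : realType} {V : finType} (Q : option V -> option V -> R).
Context (hQ : base_chain Q) (lambda : R) (hlambda : 0 < lambda).
Implicit Types (sigma : config V) (v w : V) (f g : config V -> R).
Local Notation toppleQ := (topple Q lambda).
Local Notation instr_prob := (instr_prob Q lambda).
Local Notation topple_invariant := (topple_invariant Q lambda).

(* [a xi sigma] is the probability that sigma stabilizes to xi, characterized
   without the process; the two are identified in [stab_lawE]. *)
Definition stab_family (a : sconfig V -> config V -> R) : Prop :=
  forall xi, [/\ topple_invariant (a xi), forall sigma, 0 <= a xi sigma <= 1 &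
                 forall eta, a xi (to_config eta) = (eta == xi)%:R].

Lemma exists_stab_family : exists a, stab_family a.
Proof.
by have [a ha] := choice (exists_invariant hQ hlambda); exists a.
Qed.

Section Family.
Context (a : sconfig V -> config V -> R) (ha : stab_family a).

Lemma stab_family_stable xi eta : a xi (to_config eta) = (eta == xi)%:R.
Proof. by have [_ _] := ha xi; exact. Qed.

(** The total mass is an invariant function equal to 1 at stable configurations, as is the constant
    1, so uniqueness applies. *)
Lemma stab_family_sum sigma : \sum_xi a xi sigma = 1.
Proof.
have hinv : topple_invariant (fun s => \sum_xi a xi s).
  by apply: invariant_sum => xi; case: (ha xi).
apply: (@invariant_unique _ _ _ hQ _ hlambda _ (fun=> 1)
  (#|{: sconfig V}|%:R + 1) hinv (invariant_cst hQ hlambda 1)) => [s|eta].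
  rewrite (le_trans (ler_normB _ _)) // normr1 lerD2r.
  rewrite (le_trans (ler_norm_sum _ _ _)) // -sumr_const; apply: ler_sum => xi _.
  by have [_ /(_ s)/andP[a0 a1] _] := ha xi; rewrite ger0_norm.
rewrite (bigD1 eta) //= stab_family_stable eqxx big1 ?addr0 // => xi /negbTE ne.
by rewrite stab_family_stable eq_sym ne.
Qed.

Definition stab_set (A : {set sconfig V}) sigma : R := \sum_(xi in A) a xi sigma.

Lemma stab_family_ge0 xi sigma : 0 <= a xi sigma.
Proof. by have [_ /(_ sigma)/andP[]] := ha xi. Qed.

Lemma stab_set_ge0 A sigma : 0 <= stab_set A sigma.
Proof. by rewrite sumr_ge0 // => xi _; exact: stab_family_ge0. Qed.

Lemma stab_set_le1 A sigma : stab_set A sigma <= 1.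
Proof.
rewrite -(stab_family_sum sigma) [leRHS](bigID (mem A)) /= lerDl.
by rewrite sumr_ge0 // => xi _; exact: stab_family_ge0.
Qed.

Lemma invariant_stab_set A : topple_invariant (stab_set A).
Proof. by apply: invariant_sum => xi; case: (ha xi). Qed.

(** As functions of [sigma] both sides are invariant, the left one because added particles can be
    kept frozen, and they agree at stable configurations. *)
Lemma stab_family_join xi sigma tau :
  a xi (join sigma tau) = \sum_eta a eta sigma * a xi (join (to_config eta) tau).
Proof.
pose g s := \sum_eta a xi (join (to_config eta) tau) * a eta s.
have inv_g : topple_invariant g.
  by apply: invariant_sum => eta; apply: invariantZ; case: (ha eta).
have inv_a : topple_invariant (a xi) by case: (ha xi).
transitivity (g sigma); last by apply: eq_bigr => eta _; rewrite mulrC.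
apply: (@invariant_unique _ _ _ hQ _ hlambda _ g 1
  (@invariant_join _ _ _ _ _ tau inv_a) inv_g) => [s|eta]; last first.
  rewrite /g (bigD1 eta) //= stab_family_stable eqxx mulr1 big1 ?addr0 //.
  by move=> eta' ne; rewrite stab_family_stable eq_sym (negbTE ne) mulr0.
have [_ /(_ (join s tau))/andP[a0 a1] _] := ha xi.
have g0 : 0 <= g s by rewrite sumr_ge0 // => eta _; rewrite mulr_ge0 ?stab_family_ge0.
have g1 : g s <= 1.
  rewrite -(stab_family_sum s); apply: ler_sum => eta _.
  rewrite ler_piMl ?stab_family_ge0 //.
  by have [_ /(_ (join (to_config eta) tau))/andP[]] := ha xi.
by rewrite ler_norml; apply/andP; split; lra.
Qed.

End Family.

Definition full_config : config V := [ffun=> Some 1%N].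

(** * Crowded configurations stabilize almost like the full one *)

Section Limit.
Context (f : config V -> R) (hf : topple_invariant f) (f01 : forall s, 0 <= f s <= 1).

Let D sigma := `|f sigma - f full_config|.

Let D_le1 sigma : D sigma <= 1.
Proof.
have /andP[a0 a1] := f01 sigma; have /andP[b0 b1] := f01 full_config.
by rewrite ler_norml; apply/andP; split; lra.
Qed.

Let D_topple sigma v : active sigma v -> D sigma <= toppleQ D sigma v.
Proof.
move=> av; rewrite /D.
rewrite (invariantB hf (invariant_cst hQ hlambda (f full_config)) av).
exact: ler_norm_topple.
Qed.

(* When every site is active, a site with two particles or more can be toppled
   without any site becoming inactive, until one particle per site is left. *)
Lemma invariant_full sigma : (forall v, active sigma v) ->
  f sigma = f full_config.
Proof.
move=> full; apply/eqP; rewrite -subr_eq0 -normr_le0.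
apply: (@descent _ _ Q hQ _ hlambda (fun s => forall v, active s v) D 1) => // s fs.
have [/existsP[v kv]|] := boolP [exists v, (1 < nactive (s v))%N]; last first.
  move=> /existsPn s1; left; rewrite /D; suff -> : s = full_config.
    by rewrite subrr normr0.
  apply/ffunP => v; rewrite ffunE; have := s1 v; have := fs v; rewrite /active.
  by case: (s v) => [[|[]]|].
right; exists v => //; split; first exact: D_topple.
move=> i w; have [<-|vw] := eqVneq v w; last exact: active_op.
rewrite /active opE eqxx /op_add /op_site; move: kv; case: (s v) => [[|[|k]]|] //= _.
by case: eqP => // _; case: i.
Qed.

Section Crowded.
Context (v : V).

Let bounds := [set b : R | exists N : nat, forall sigma,
                 (N <= nactive (sigma v))%N -> D sigma <= b].

Let beta := inf bounds.

Let has_inf_bounds : has_inf bounds.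
Proof.
split; first by exists 1, 0%N.
exists 0 => b [N Nb].
by apply: le_trans (Nb [ffun=> Some N] _); rewrite ?ffunE // normr_ge0.
Qed.

Let upper eps : 0 < eps -> exists N : nat, forall sigma,
  (N <= nactive (sigma v))%N -> D sigma <= beta + eps.
Proof.
move=> e0; have [b [N Nb] be] := inf_adherent e0 has_inf_bounds.
by exists N => s /Nb Ds; rewrite (le_trans Ds) // ltW.
Qed.

(* Maximum principle: beta is the limit superior of D as the number of particles
   at v grows, and the property of being met by configurations nearly attaining
   beta is propagated by topplings, until all sites are active, where D = 0. *)
Let persists (G : config V -> Prop) := forall eps, 0 < eps -> forall N : nat,
  exists sigma, [/\ (N <= nactive (sigma v))%N, G sigma & beta - eps < D sigma].

Let persists_all : persists (fun=> True).
Proof.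
move=> eps e0 N; apply: contrapT => H.
have : beta <= beta - eps.
  apply: (ge_inf (proj2 has_inf_bounds)); exists N => s Ns.
  by rewrite leNgt; apply/negP => lt; apply: H; exists s.
lra.
Qed.

(** All outcomes are at most [beta + eps * p / 2] while their average is above [beta - eps * p / 2];
    so the outcome of i, which has probability p, is above [beta - eps]. *)
Let persists_op (G G' : config V -> Prop) x i : persists G ->
  0 < instr_prob x i -> (forall s, G s -> active s x) ->
  (forall s, G s -> G' (op s x i)) -> persists G'.
Proof.
move=> pG p0 Gx GG' eps e0 N; set p := instr_prob x i in p0.
have ep0 : 0 < eps * p / 2 by rewrite divr_gt0 // mulr_gt0.
have [N1 hN1] := upper ep0.
(* The margin keeps both thresholds valid after the instruction, which may remove a particle from
   v. *)
have [s [Ns Gs Ds]] := pG _ ep0 (maxn N N1).+2.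
have cnt j : (maxn N N1 <= nactive (op s x j v))%N.
  rewrite opE /op_add /op_site; move: Ns; case: (s v) => //= k; set M := maxn N N1.
  move=> Mk; have M2 : (M <= k.-1)%N by lia.
  case: eqP => // _; case: eqP => // _; case: j => [?|] /=; try lia.
  - by case: eqP => [[]|] /=; lia.
  - by case: eqP => [[]|] /=; lia.
exists (op s x i); split; first by have := cnt i; lia.
  exact: GG'.
have : D s <= p * D (op s x i) + (1 - p) * (beta + eps * p / 2).
  apply: (le_trans (D_topple (Gx _ Gs))).
  rewrite /topple (bigD1 i) //= lerD2l.
  have -> : 1 - p = \sum_(j | j != i) instr_prob x j.
    by have := sum_instr_prob hQ hlambda x; rewrite (bigD1 i) //= -/p; lra.
  rewrite mulr_suml; apply: ler_sum => j _; rewrite ler_wpM2l ?instr_prob_ge0 //.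
  by apply: hN1; have := cnt j; lia.
move=> H; rewrite -(ltr_pM2l p0); nra.
Qed.

(** x marks a site holding one particle more than F asks for, the one being carried along a path;
    [None] means that nothing is carried. *)
Let loaded (F : seq V) (x : option V) sigma :=
  forall w, ((w \in F) + (Some w == x) <= nactive (sigma w))%N.

Let persists_jump F x y : 0 < Q (Some x) (Some y) ->
  persists (loaded F (Some x)) -> persists (loaded F (Some y)).
Proof.
move=> Qxy pF; apply: (@persists_op _ _ x (Some (Some y)) pF).
- by rewrite divr_gt0 ?lambda1_gt0.
- by move=> s /(_ x); rewrite eqxx addn1 /active; apply: leq_ltn_trans.
move=> s sF w; have := sF w; rewrite opE /op_add /op_site !(inj_eq (@Some_inj _)).
rewrite [y == w]eq_sym.
by case: eqP => _; case: eqP => _; case: (s w) => [k|] /=; case: (w \in F) => /=; lia.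
Qed.

Let persists_path F x p w : path (fun x y => 0 < Q x y) (Some x) p ->
  last (Some x) p = Some w -> persists (loaded F (Some x)) ->
  persists (loaded F (Some w)).
Proof.
elim: p x => [|[y|] p IH] x /=; first by move=> _ [->].
  by case/andP=> Qxy py lp /(persists_jump Qxy); exact: IH.
(* A path that enters the sink stays there, so it cannot end at w. *)
case/andP=> _ pN lN _; exfalso.
suff : last None p = None :> option V by rewrite lN.
elim: p pN {lN IH} => //= y p IH /andP[]; rewrite base_chain_sink //.
by case: eqP => [->|] _; [exact: IH | rewrite ltxx].
Qed.

(** Sites are activated one by one: v, which is arbitrarily crowded, supplies a particle that is
    carried to the new site along a path of Q, with the sites of F kept active. *)
Let persists_loaded F : persists (loaded F None).
Proof.
elim: F => [|w F IH].
  move=> eps e0 N; have [s [Ns _ Ds]] := persists_all e0 N.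
  by exists s; split.
have hv : persists (loaded F (Some v)).
  (* Two particles at v: one that F may ask for, one to carry. *)
  move=> eps e0 N; have [s [Ns Fs Ds]] := IH _ e0 (maxn N 2).
  exists s; split => //; first by lia.
  move=> u; have := Fs u; rewrite (inj_eq (@Some_inj _)).
  by case: (u =P v) => [->|]; [case: (v \in F) => /=; lia | rewrite addn0].
have [_ _ _ /(_ v w)/connectP[p vp lp] _] := hQ.
move=> eps e0 N; have [s [Ns Fs Ds]] := persists_path vp (esym lp) hv e0 N.
exists s; split => // u; have := Fs u; rewrite inE (inj_eq (@Some_inj _)) addn0.
by case: (u == w); case: (u \in F) => //=; lia.
Qed.

(** If [beta] were positive, [persists_loaded] with eps equal to [beta] would give a configuration
    with D positive and all sites active, against [invariant_full]. *)
Lemma crowded_limit eps : 0 < eps -> exists N : nat, forall sigma,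
  (N <= nactive (sigma v))%N -> `|f sigma - f full_config| <= eps.
Proof.
move=> e0; have beta0 : beta <= 0.
  rewrite leNgt; apply/negP => b0.
  have [s [_ Fs]] := persists_loaded (enum V) b0 0%N.
  rewrite /D invariant_full ?subrr ?normr0 ?ltxx // => w.
  by have := Fs w; rewrite mem_enum inE addn0.
have [N hN] := upper e0; exists N => s /hN Ds.
by rewrite (le_trans Ds) // gerDr.
Qed.

End Crowded.

Definition counts (us : seq V) : {ffun V -> nat} := [ffun v => count_mem v us].

(** Pigeonhole: many driving particles crowd some vertex whichever sequence is used, so the bound is
    uniform in [us] and [sigma]. *)
Lemma crowd_limit eps : 0 < eps -> exists t : nat, forall us, size us = t ->
  forall sigma, `|f (join sigma (counts us)) - f full_config| <= eps.
Proof.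
move=> e0; have [N hN] := choice (fun v => @crowded_limit v eps e0).
exists (\sum_v N v).+1 => us sus sigma.
have [/existsP[v Nv]|/existsPn all_lt] := boolP [exists v, (N v <= count_mem v us)%N].
  apply: (hN v); rewrite !ffunE; move: Nv; case: (count_mem v us) => [|k] //=; last by lia.
  by rewrite leqn0 => /eqP ->.
have : (\sum_v count_mem v us <= \sum_v N v)%N.
  by apply: leq_sum => v _; have := all_lt v; rewrite -ltnNge; exact: ltnW.
suff -> : (\sum_v count_mem v us)%N = size us by rewrite sus ltnn.
elim: us {sus all_lt} => [|u us IH] /=; first by rewrite big1.
rewrite big_split /= IH (bigD1 u) //= eqxx big1 // => w.
by rewrite eq_sym => /negbTE ->.
Qed.

End Limit.

End StabilizationFamily.

(** * The embedded jump chain *)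

Section JumpChain.
Context {R : realType} {V : finType} (Q : option V -> option V -> R).
Context (hQ : base_chain Q) (lambda : R) (hlambda : 0 < lambda).
Implicit Types (sigma tau : config V) (v w : V) (f g : config V -> R).
Local Notation toppleQ := (topple Q lambda).
Local Notation topple_invariant := (topple_invariant Q lambda).
Local Notation rate := (rate Q lambda).
Local Notation exit_rate := (exit_rate Q lambda).
Local Notation jump_prob := (jump_prob Q lambda).

(** A finite list, so that expectations over the infinite set of configurations are finite sums;
    [sigma] itself is included for the absorbed case. *)
Definition successors sigma : seq (config V) :=
  undup (sigma :: [seq jump sigma v x | v <- enum V, x <- enum {: option V}]
               ++ [seq fall_asleep sigma v | v <- enum V]).

Lemma mem_successors_jump sigma v x : jump sigma v x \in successors sigma.
Proof.
rewrite mem_undup inE mem_cat; apply/orP; right; apply/orP; left.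
by apply/allpairsP; exists (v, x); rewrite !mem_enum.
Qed.

Lemma mem_successors_sleep sigma v : fall_asleep sigma v \in successors sigma.
Proof.
rewrite mem_undup inE mem_cat; apply/orP; right; apply/orP; right.
by apply/mapP; exists v; rewrite ?mem_enum.
Qed.

Lemma mem_successors_self sigma : sigma \in successors sigma.
Proof. by rewrite mem_undup mem_head. Qed.

Lemma rateE sigma (A : pred (config V)) : rate sigma A =
  \sum_v (nactive (sigma v))%:R * \sum_x Q (Some v) x * (A (jump sigma v x))%:R
  + \sum_v (sigma v == Some 1%N)%:R * lambda * (A (fall_asleep sigma v))%:R.
Proof.
congr (_ + _).
  apply: eq_bigr => v _; congr (_ * _); rewrite big_mkcond; apply: eq_bigr => x _.
  by case: (A _); rewrite ?mulr1 ?mulr0.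
rewrite big_mkcond; apply: eq_bigr => v _.
by case: (_ == _); case: (A _); rewrite ?mul1r ?mul0r ?mulr1 ?mulr0.
Qed.

Lemma rate_ge0 sigma (A : pred (config V)) : 0 <= rate sigma A.
Proof.
rewrite addr_ge0 ?sumr_ge0 // => v _; last exact: ltW.
by rewrite mulr_ge0 // sumr_ge0 // => x _; exact: base_chain_ge0.
Qed.

Lemma rate_le_exit sigma tau : tau != sigma -> rate sigma (pred1 tau) <= exit_rate sigma.
Proof.
move=> ne; rewrite /Defs.exit_rate !rateE.
have le_ind s : (pred1 tau s)%:R <= (predC1 sigma s)%:R :> R.
  by rewrite /=; case: eqP => [->|]; rewrite ?ne.
apply: lerD; apply: ler_sum => v _.
  apply: ler_wpM2l => //; apply: ler_sum => x _; apply: ler_wpM2l => //.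
  exact: base_chain_ge0.
by apply: ler_wpM2l => //; rewrite mulr_ge0 // ltW.
Qed.

Lemma sum_rate sigma g :
  \sum_(tau <- successors sigma | tau != sigma) rate sigma (pred1 tau) * g tau
  = \sum_v (nactive (sigma v))%:R *
      \sum_x Q (Some v) x * (jump sigma v x != sigma)%:R * g (jump sigma v x)
  + \sum_v (sigma v == Some 1%N)%:R * lambda * (fall_asleep sigma v != sigma)%:R
      * g (fall_asleep sigma v).
Proof.
have pick s c : s \in successors sigma ->
    \sum_(tau <- successors sigma | tau != sigma) c * (s == tau)%:R * g tau =
    c * (s != sigma)%:R * g s.
  move=> ss; rewrite big_mkcond (bigD1_seq s) ?undup_uniq //= eqxx mulr1.
  rewrite big1 ?addr0 => [|t ts]; first by case: (s == sigma); rewrite ?mulr0 ?mul0r ?mulr1.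
  by rewrite [s == t]eq_sym (negbTE ts) mulr0 mul0r if_same.
under eq_bigr do rewrite rateE mulrDl !mulr_suml.
rewrite big_split /=; congr (_ + _).
  rewrite exchange_big /=; apply: eq_bigr => v _.
  under eq_bigr do rewrite -mulrA mulr_suml.
  rewrite -mulr_sumr; congr (_ * _); rewrite exchange_big /=.
  by apply: eq_bigr => x _; apply: pick; exact: mem_successors_jump.
rewrite exchange_big /=; apply: eq_bigr => v _.
by apply: pick; exact: mem_successors_sleep.
Qed.

Lemma exit_rateE sigma :
  exit_rate sigma = \sum_(tau <- successors sigma | tau != sigma) rate sigma (pred1 tau).
Proof.
have := sum_rate sigma (fun=> 1); under eq_bigr do rewrite mulr1; move=> ->.
rewrite /Defs.exit_rate rateE; congr (_ + _); apply: eq_bigr => v _; rewrite ?mulr1 //.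
by congr (_ * _); apply: eq_bigr => x _; rewrite mulr1.
Qed.

(** Each active particle carries a clock of rate [1 + lambda] that triggers instructions. Sleep
    instructions at a site with several particles and jumps back to the same site change nothing, so
    they contribute 0. *)
Lemma generatorE sigma f :
  \sum_(tau <- successors sigma | tau != sigma) rate sigma (pred1 tau) * (f tau - f sigma)
  = (1 + lambda) * \sum_v (nactive (sigma v))%:R * (toppleQ f sigma v - f sigma).
Proof.
rewrite (sum_rate sigma (fun s => f s - f sigma)) -big_split mulr_sumr /=.
apply: eq_bigr => v _.
have drop s c : c * (s != sigma)%:R * (f s - f sigma) = c * (f s - f sigma).
  by case: eqP => [->|_]; rewrite ?subrr ?mulr0 // mulr1.
rewrite drop; under eq_bigr do rewrite drop mulrBr.
rewrite sumrB -mulr_suml base_chain_sum // mul1r.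
rewrite toppleE; move: (\sum_x _) => S; have l0 := lambda1_gt0 hlambda.
have -> : f (op sigma v None) =
    if sigma v == Some 1%N then f (fall_asleep sigma v) else f sigma.
  case: ifP => s1; congr f; apply/ffunP => u; rewrite opE /op_add /op_site /=.
    by rewrite ffunE; case: eqP => // ->; rewrite s1.
  by case: eqP => // ->; rewrite s1.
case: eqP => [->|_] /=; last by field; rewrite gt_eqF.
by field; rewrite gt_eqF.
Qed.

Lemma jump_prob_ge0 sigma tau : 0 <= jump_prob sigma tau.
Proof.
rewrite /Defs.jump_prob; case: ifP => // _; case: ifP => // _.
by rewrite divr_ge0 // rate_ge0.
Qed.

Lemma jump_prob_le1 sigma tau : jump_prob sigma tau <= 1.
Proof.
rewrite /Defs.jump_prob; case: ifPn => e0; first by case: eqP.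
case: ifPn => ne //; rewrite ler_pdivrMr ?mul1r ?rate_le_exit //.
by rewrite lt_def e0 rate_ge0.
Qed.

Definition mean sigma f : R := \sum_(tau <- successors sigma) jump_prob sigma tau * f tau.

Lemma le_mean sigma f g : (forall tau, f tau <= g tau) -> mean sigma f <= mean sigma g.
Proof. by move=> fg; apply: ler_sum => t _; rewrite ler_wpM2l ?jump_prob_ge0. Qed.

Lemma meanB sigma f g : mean sigma (fun s => f s - g s) = mean sigma f - mean sigma g.
Proof. by rewrite /mean -sumrB; apply: eq_bigr => t _; rewrite mulrBr. Qed.

Lemma meanZ sigma c f : mean sigma (fun s => c * f s) = c * mean sigma f.
Proof. by rewrite /mean mulr_sumr; apply: eq_bigr => t _; rewrite mulrCA. Qed.

Lemma ler_norm_mean sigma f : `|mean sigma f| <= mean sigma (fun s => `|f s|).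
Proof.
apply: le_trans (ler_norm_sum _ _ _) _; apply: ler_sum => t _.
by rewrite normrM ger0_norm ?jump_prob_ge0.
Qed.

Lemma mean_absorbed sigma f : exit_rate sigma = 0 -> mean sigma f = f sigma.
Proof.
move=> e0; rewrite /mean (bigD1_seq sigma) ?undup_uniq ?mem_successors_self //=.
rewrite /Defs.jump_prob e0 eqxx eqxx mul1r big1 ?addr0 // => t /negbTE ne.
by rewrite ne mul0r.
Qed.

Lemma mean_generator sigma f :
  exit_rate sigma * (mean sigma f - f sigma)
  = (1 + lambda) * \sum_v (nactive (sigma v))%:R * (toppleQ f sigma v - f sigma).
Proof.
rewrite -generatorE; have [e0|e0] := eqVneq (exit_rate sigma) 0.
  rewrite e0 mul0r big1 // => t ts; apply/eqP; rewrite mulf_eq0; apply/orP; left.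
  by rewrite eq_le rate_ge0 andbT -e0 rate_le_exit.
rewrite mulrBr /mean mulr_sumr.
under [in RHS]eq_bigr do rewrite mulrBr.
rewrite sumrB -mulr_suml -exit_rateE; congr (_ - _).
rewrite [RHS]big_mkcond; apply: eq_bigr => t _; rewrite /Defs.jump_prob (negbTE e0).
case: eqP => [_|_] /=; first by rewrite mul0r mulr0.
by rewrite mulrA [exit_rate _ * _]mulrC mulfVK.
Qed.

(** The passage from topplings to the process: the generator is a combination of topplings, so
    invariant functions are harmonic for the jump chain. *)
Lemma mean_invariant sigma f : topple_invariant f -> mean sigma f = f sigma.
Proof.
move=> hf; have [e0|e0] := eqVneq (exit_rate sigma) 0; first exact: mean_absorbed.
apply/eqP; rewrite -subr_eq0 -(mulrI_eq0 _ (mulfI e0)) mean_generator.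
rewrite big1 ?mulr0 // => v _; have [->|k0] := posnP (nactive (sigma v)).
  by rewrite mul0r.
by rewrite -hf // subrr mulr0.
Qed.

(** The drift is at most minus the number [K] of active particles, which rules out a zero exit rate;
    as the exit rate is at most [(1 + lambda) * K], a jump lowers the mean energy by at least
    [(1 + lambda)^-1]. *)
Lemma mean_le_energy pot sigma : is_potential Q pot -> ~~ stable sigma ->
  0 < exit_rate sigma /\
  mean sigma (energy pot) <= energy pot sigma - (1 + lambda)^-1.
Proof.
move=> hpot unst; have l0 := lambda1_gt0 hlambda.
pose K : R := \sum_v (nactive (sigma v))%:R.
have K0 : 0 < K.
  have [v av] := unstableP unst; rewrite /K (bigD1 v) //=.
  by rewrite ltr_wpDr ?sumr_ge0 // ltr0n.
have drift : exit_rate sigma * (mean sigma (energy pot) - energy pot sigma) <= - K.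
  rewrite mean_generator mulr_sumr /K -[leRHS]sumrN; apply: ler_sum => v _.
  have [->|k0] := posnP (nactive (sigma v)); first by rewrite mul0r mulr0 oppr0.
  have := topple_energy hQ hlambda hpot (k0 : active sigma v).
  set T := topple _ _ _ _ _ => HT.
  by rewrite mulrCA -[leRHS]mulrN1 ler_wpM2l // -ler_pdivlMl // mulrN1; lra.
have e0 : 0 < exit_rate sigma.
  rewrite lt_def rate_ge0 andbT; apply/eqP => e0.
  by move: drift; rewrite e0 mul0r; lra.
have exit_le : exit_rate sigma <= (1 + lambda) * K.
  rewrite /Defs.exit_rate rateE /K mulr_sumr -big_split /=; apply: ler_sum => v _.
  rewrite mulrDl mul1r; apply: lerD.
    rewrite ler_piMr // -[leRHS](base_chain_sum hQ (Some v)); apply: ler_sum => x _.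
    by rewrite ler_piMr ?base_chain_ge0 //; case: (_ == _).
  case: eqP => [->|_]; last by rewrite !mul0r mulr_ge0 // ltW.
  by rewrite mul1r mulr1 ler_piMr ?(ltW hlambda) //; case: (_ == _).
split => //; move: drift exit_le e0; set e := exit_rate sigma.
set m := mean _ _; move=> drift exit_le e0.
have : (m - energy pot sigma) <= - K / e by rewrite ler_pdivlMr // mulrC.
have : (1 + lambda)^-1 <= K / e.
  by rewrite ler_pdivlMr // mulrC ler_pdivrMr // mulrC.
by rewrite mulNr; lra.
Qed.

Lemma exit_rate_stable sigma : stable sigma -> exit_rate sigma = 0.
Proof.
move=> /forallP st; rewrite /Defs.exit_rate rateE !big1 ?addr0 // => v _.
  by case: eqP (st v) => [|_ _]; [rewrite /active => -> | rewrite !mul0r].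
by have := st v; rewrite /active lt0n negbK => /eqP ->; rewrite mul0r.
Qed.

Lemma jump_prob_stable sigma tau : stable sigma -> jump_prob sigma tau = (tau == sigma)%:R.
Proof. by move=> /exit_rate_stable e0; rewrite /Defs.jump_prob e0 eqxx. Qed.

(* Probability that, n jumps after being at sigma with U the set of sites still
   to be visited, the chain and the set of unvisited sites satisfy T. *)
Fixpoint reach (T : config V -> {set V} -> bool) (n : nat) sigma (U : {set V}) : R :=
  let U' := [set v in U | ~~ active sigma v] in
  if n is n'.+1 then mean sigma (fun tau => reach T n' tau U') else (T sigma U')%:R.

Lemma reach_ge0 T n sigma U : 0 <= reach T n sigma U.
Proof.
elim: n sigma U => //= n IH sigma U.
by rewrite sumr_ge0 // => t _; rewrite mulr_ge0 ?jump_prob_ge0.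
Qed.

Lemma reach_stable T n sigma U : stable sigma -> reach T n sigma U = (T sigma U)%:R.
Proof.
move=> st; have same (A : {set V}) : [set v in A | ~~ active sigma v] = A.
  by apply/setP => v; rewrite inE (forallP st) andbT.
elim: n U => /= [|n IH] U; first by rewrite same.
by rewrite mean_absorbed ?exit_rate_stable // IH same.
Qed.

(** Inductive step shared by the energy arguments for the jump chain: the energy lost in one jump
    pays for one more copy of d, which is at most 1. *)
Lemma mean_descent pot sigma n d (F : config V -> R) : is_potential Q pot ->
  ~~ stable sigma -> d <= 1 -> d <= mean sigma F ->
  (forall tau, n%:R * F tau <= (1 + lambda) * energy pot tau) ->
  n.+1%:R * d <= (1 + lambda) * energy pot sigma.
Proof.
move=> hpot unst d1 dF HF; rewrite -natr1 mulrDl mul1r.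
have H1 : n%:R * d <= n%:R * mean sigma F by rewrite ler_wpM2l.
have H2 : n%:R * mean sigma F <= (1 + lambda) * mean sigma (energy pot).
  by rewrite -!meanZ; exact: le_mean.
have l0 := lambda1_gt0 hlambda.
have H3 : (1 + lambda) * mean sigma (energy pot) <= (1 + lambda) * energy pot sigma - 1.
  have [_ Hm] := mean_le_energy hpot unst.
  apply: le_trans (ler_wpM2l (ltW l0) Hm) _.
  by rewrite mulrBr divff ?gt_eqF.
lra.
Qed.

(* A uniform bound on the number of jumps is not available, but by the energy
   argument the probability of more than n jumps is O(1 / n). *)
Lemma stab_family_le_reach a xi sigma U r : stab_family Q lambda a ->
  (forall n, reach (fun s _ => s == to_config xi) n sigma U <= r) -> a xi sigma <= r.
Proof.
move=> ha Hr; have [pot hpot] := exists_potential hQ.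
have pot0 s := energy_ge0 s hpot.
have [inv a01 a_st] := ha xi; have l0 := ltW (lambda1_gt0 hlambda).
rewrite -subr_le0.
apply: (@le0_of_natmul_bounded _ _ ((1 + lambda) * energy pot sigma)) => n.
apply: (@le_trans _ _ (n%:R * (a xi sigma - reach (fun s _ => s == to_config xi) n sigma U))).
  by rewrite ler_wpM2l // lerD2l lerN2.
elim: n sigma U {Hr} => [|n IH] sigma U; first by rewrite mul0r mulr_ge0.
have [st|unst] := boolP (stable sigma).
  rewrite reach_stable //; have [eta ->] := stableE st.
  by rewrite a_st (inj_eq (@to_config_inj _)) subrr mulr0 mulr_ge0.
pose U' := [set v in U | ~~ active sigma v].
apply: (@mean_descent pot sigma n _
  (fun t => a xi t - reach (fun s _ => s == to_config xi) n t U') hpot unst) => [||t].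
- have := reach_ge0 (fun s _ => s == to_config xi) n.+1 sigma U.
  by have /andP[_] := a01 sigma; lra.
- by rewrite meanB (mean_invariant sigma inv).
- exact: IH.
Qed.

End JumpChain.

(** * Coupling with jumping extra particles *)

Section Scatter.
Context {R : realType} {V : finType} (Q : option V -> option V -> R).
Context (hQ : base_chain Q).
Implicit Types (u v : V) (p : {ffun V -> option V}) (g : {ffun V -> option V} -> R).

Definition move p u x : {ffun V -> option V} := [ffun w => if w == u then x else p w].

(* Expectation of g after each of the particles listed in B has made one jump
   from its position in p. *)
Fixpoint scatter (B : seq V) g p : R :=
  if B is u :: B' then \sum_x Q (p u) x * scatter B' g (move p u x) else g p.

Lemma le_scatter B g g' p : (forall p', g p' <= g' p') ->
  scatter B g p <= scatter B g' p.
Proof.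
move=> gg'; elim: B p => //= u B IH p; apply: ler_sum => x _.
by rewrite ler_wpM2l ?base_chain_ge0.
Qed.

Lemma scatter_cst B c p : scatter B (fun=> c) p = c.
Proof.
elim: B p => //= u B IH p; under eq_bigr do rewrite IH.
by rewrite -mulr_suml base_chain_sum // mul1r.
Qed.

Lemma scatterB B g g' p :
  scatter B (fun p' => g p' - g' p') p = scatter B g p - scatter B g' p.
Proof.
elim: B p => //= u B IH p; rewrite -sumrB; apply: eq_bigr => x _.
by rewrite IH mulrBr.
Qed.

Lemma scatter_norm B g p c : (forall p', `|g p'| <= c) -> `|scatter B g p| <= c.
Proof.
move=> gc; rewrite ler_norml; apply/andP; split.
  rewrite -(scatter_cst B (- c) p); apply: le_scatter => p'.
  by have := gc p'; rewrite ler_norml => /andP[].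
rewrite -(scatter_cst B c p); apply: le_scatter => p'.
by have := gc p'; rewrite ler_norml => /andP[].
Qed.

Lemma move_comm p u v x y : u != v -> move (move p u x) v y = move (move p v y) u x.
Proof.
move=> uv; apply/ffunP => w; rewrite !ffunE.
by have [->|//] := eqVneq w v; rewrite eq_sym (negbTE uv).
Qed.

(** Independent jumps of distinct particles can be made in any order, so the coupling may choose
    which one jumps first. *)
Lemma scatter_rem B g p u : uniq B -> u \in B ->
  scatter B g p = \sum_x Q (p u) x * scatter (rem u B) g (move p u x).
Proof.
elim: B p => //= v B IH p /andP[vB uB]; rewrite inE => /predU1P[->|u_in].
  by rewrite eqxx.
have vu : v != u by apply: contraNneq vB => ->.
rewrite (negbTE vu) /=; under eq_bigr do rewrite IH // mulr_sumr.
under [RHS]eq_bigr do rewrite mulr_sumr.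
rewrite exchange_big /=; apply: eq_bigr => x _; apply: eq_bigr => y _.
by rewrite !ffunE eq_sym (negbTE vu) move_comm // mulrCA.
Qed.

(** The successive jumps amount to one step of the product kernel; this links the coupling with the
    simultaneous walks. *)
Lemma scatterE g p :
  scatter (enum V) g p = \sum_(p' : {ffun V -> option V}) (\prod_u Q (p u) (p' u)) * g p'.
Proof.
(* For a partial list, particles outside B keep their positions, which appears as an indicator
   factor. *)
have gen B : uniq B -> forall p, scatter B g p =
    \sum_(p' : {ffun V -> option V})
      (\prod_u (if u \in B then Q (p u) (p' u) else (p' u == p u)%:R)) * g p'.
  elim: B => [_|u B IH /= /andP[uB B_uniq]] q /=.
    rewrite (bigD1 q) //= big1 => [|w _]; last by rewrite eqxx.
    rewrite mul1r big1 ?addr0 // => q' qq'.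
    have [w ne] : exists w, q' w != q w.
      by apply/existsP; apply: contraNT qq' => /existsPn H; apply/eqP/ffunP => w;
        apply/eqP; have := H w; rewrite negbK.
    by rewrite (bigD1 w) //= (negbTE ne) !mul0r.
  under eq_bigr do rewrite IH // mulr_sumr.
  rewrite exchange_big /=; apply: eq_bigr => q' _.
  under eq_bigr do rewrite mulrA.
  rewrite -mulr_suml; congr (_ * _).
  rewrite (bigD1 (q' u)) //= [X in _ + X]big1 ?addr0 => [|x xq].
    rewrite (bigD1 u) //= [in RHS](bigD1 u) //= mem_head (negbTE uB) ffunE eqxx eqxx mul1r.
    congr (_ * _); apply: eq_bigr => w wu.
    by rewrite inE (negbTE wu) /= ffunE (negbTE wu).
  by rewrite (bigD1 u) //= (negbTE uB) ffunE eqxx eq_sym (negbTE xq) mul0r mulr0.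
rewrite gen ?enum_uniq //; apply: eq_bigr => p' _; congr (_ * _).
by apply: eq_bigr => u _; rewrite mem_enum.
Qed.

Definition all_home : {ffun V -> option V} := [ffun v => Some v].
Definition all_sunk : {ffun V -> option V} := [ffun=> None].

(* Probability that the walks started from p are not all at the sink after n steps. *)
Definition escape (n : nat) p : R :=
  iter n (scatter (enum V)) (fun p => (p != all_sunk)%:R) p.

Lemma escapeS n p : escape n.+1 p =
  \sum_(p' : {ffun V -> option V}) (\prod_u Q (p u) (p' u)) * escape n p'.
Proof. by rewrite /escape iterS scatterE. Qed.

Lemma escape_sunk n : escape n all_sunk = 0.
Proof.
elim: n => [|n IH]; first by rewrite /escape /= eqxx.
rewrite escapeS (bigD1 all_sunk) //= IH mulr0 add0r big1 // => p pN.
have [w ne] : exists w, p w != None.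
  by apply/existsP; apply: contraNT pN => /existsPn H; apply/eqP/ffunP => w;
    rewrite ffunE; apply/eqP; have := H w; rewrite negbK.
by rewrite (bigD1 w) //= ffunE base_chain_sink // (negbTE ne) !mul0r.
Qed.

(** Iterate [scatter] n times: each iteration costs at most r, since averaging does not increase the
    supremum norm, and the final result is within [escape n p] of c. *)
Lemma escape_bound g c r n p :
  (forall q, `|g q - scatter (enum V) g q| <= r) ->
  (forall q, `|g q - c| <= (q != all_sunk)%:R) ->
  `|g p - c| <= n%:R * r + escape n p.
Proof.
move=> gr gc; pose G k := iter k (scatter (enum V)) g.
have near_g k q : `|g q - G k q| <= k%:R * r.
  elim: k q => [|k IH] q /=; first by rewrite subrr normr0 mul0r.
  rewrite -natr1 mulrDl mul1r [leRHS]addrC.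
  apply: le_trans (ler_distD (scatter (enum V) g q) _ _) _.
  by apply: lerD => //; rewrite -scatterB; exact: scatter_norm.
have near_c k q : `|G k q - c| <= escape k q.
  elim: k q => [|k IH] q; first exact: gc.
  rewrite -(scatter_cst (enum V) c q) /G /escape !iterS -scatterB ler_norml.
  rewrite lerNl -[X in X <= _ ]sub0r -(scatter_cst (enum V) 0 q) -scatterB.
  by apply/andP; split; apply: le_scatter => q';
    have := IH q'; rewrite ler_norml => /andP[]; rewrite /G /escape; lra.
exact: le_trans (ler_distD (G n p) _ _) (lerD (near_g n p) (near_c n p)).
Qed.

End Scatter.

(** * Releasing the added particles while sigma evolves *)

Section Coupling.
Context {R : realType} {V : finType} (Q : option V -> option V -> R).
Context (hQ : base_chain Q) (lambda : R) (hlambda : 0 < lambda).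
Context (f : config V -> R) (hf : topple_invariant Q lambda f).
Context (f01 : forall s, 0 <= f s <= 1).
Implicit Types (sigma : config V) (u v w : V) (p : {ffun V -> option V}) (B : seq V).

Definition occupation p : {ffun V -> nat} := [ffun v => (\sum_u (p u == Some v))%N].

Lemma add_site_join s k : add_site (join_site s k) = join_site s k.+1.
Proof. by case: k => [|k]; case: s => [l|] //=; rewrite ?addn1 ?addnS. Qed.

Lemma occupation_move p u x w :
  (occupation (move p u x) w + (p u == Some w) = occupation p w + (x == Some w))%N.
Proof.
rewrite !ffunE (bigD1 u) //= [in RHS](bigD1 u) //= ffunE eqxx.
rewrite (eq_bigr (fun u0 => (p u0 == Some w : nat))) => [|u0 /negbTE ne]; first by lia.
by rewrite ffunE ne.
Qed.

(** Particles at v being indistinguishable, the one that jumps may be taken to be the added particle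
    u. *)
Lemma jump_occupation sigma p u v x : active sigma v -> p u = Some v ->
  jump (join sigma (occupation p)) v x = join sigma (occupation (move p u x)).
Proof.
move=> av pu; apply/ffunP => w.
rewrite -[LHS]/(op _ _ (Some x) w) opE /op_add /op_site !(inj_eq (@Some_inj _)).
have := occupation_move p u x w; rewrite pu (inj_eq (@Some_inj _)) [v == w]eq_sym.
rewrite [in X in X -> _]/(occupation _) ![(join _ _) w]ffunE.
move: (occupation p w) (occupation (move p u x) w) => k k' kk'.
have s_pos : w = v -> exists l, sigma w = Some l.+1.
  by move=> ->; move: av; rewrite /active; case: (sigma v) => [[|l]|] //; exists l.
case: (x == Some w) kk'; case: (w =P v) s_pos => [wv /(_ wv)[l ->]|_ _] /=;
  rewrite ?addn0 ?addn1.
- by move=> -[->]; case: k => //= k; rewrite addSn.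
- by move=> ->; rewrite add_site_join.
- by move=> <-; case: k' => [|k'] /=; rewrite ?addn1 ?addnS.
- by move=> ->.
Qed.

(** Error in the expectation when the added particles of B, held frozen at p, make one more jump. *)
Definition defect sigma B p : R :=
  f (join sigma (occupation p)) - scatter Q B (fun p' => f (join sigma (occupation p'))) p.

Lemma scatter01 sigma B p :
  0 <= scatter Q B (fun p' => f (join sigma (occupation p'))) p <= 1.
Proof.
apply/andP; split.
  rewrite -[leLHS](scatter_cst hQ B 0 p) le_scatter // => p'.
  by case/andP: (f01 (join sigma (occupation p'))).
rewrite -[leRHS](scatter_cst hQ B 1 p) le_scatter // => p'.
by case/andP: (f01 (join sigma (occupation p'))).
Qed.

Lemma defect_le1 sigma B p : `|defect sigma B p| <= 1.
Proof.
have /andP[a0 a1] := scatter01 sigma B p.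
have /andP[b0 b1] := f01 (join sigma (occupation p)).
by rewrite ler_norml; apply/andP; split; rewrite /defect; lra.
Qed.

Lemma invariant_defect B p : topple_invariant Q lambda (fun sigma => defect sigma B p).
Proof.
apply: invariantB; first exact: (invariant_join _ hf).
elim: B p => [|u B IH] p /=; first exact: (invariant_join _ hf).
by apply: invariant_sum => x; apply: invariantZ.
Qed.

(* A particle added on top of an active one can be made to jump at no cost. *)
Lemma defect_jump sigma B p u : uniq B -> u \in B ->
  (if p u is Some v then active sigma v else true) ->
  `|defect sigma B p| <= \sum_x Q (p u) x * `|defect sigma (rem u B) (move p u x)|.
Proof.
move=> uB u_in pu.
have -> : defect sigma B p = \sum_x Q (p u) x * defect sigma (rem u B) (move p u x).
  rewrite /defect (scatter_rem _ _ _ uB u_in).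
  under [in RHS]eq_bigr do rewrite mulrBr.
  rewrite sumrB; congr (_ - _); case E : (p u) pu => [v|] av.
    rewrite (@invariant_jump _ _ Q _ hlambda f _ v) //.
      by apply: eq_bigr => x _; rewrite (jump_occupation _ av E).
    rewrite !ffunE; have : (0 < \sum_u0 (p u0 == Some v))%N.
      by rewrite (bigD1 u) //= E eqxx.
    move: av; rewrite /active; case: (sigma v) => //= k.
    by case: (\sum_ _ _)%N => //= l; lia.
  rewrite (bigD1 None) //= base_chain_sink // mul1r big1 => [|x xN].
    rewrite addr0; congr (f (join _ (occupation _))).
    by apply/ffunP => w; rewrite ffunE; case: eqP => // ->.
  by rewrite base_chain_sink // (negbTE xN) mul0r.
apply: le_trans (ler_norm_sum _ _ _) _; apply: ler_sum => x _.
by rewrite normrM ger0_norm ?base_chain_ge0.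
Qed.

Definition unvisited_end sigma (U : {set V}) : bool := stable sigma && (U != finset.set0).

(** As n grows, this bounds the defect by the probability of stabilizing with a site of U unvisited.
    The particles of B, those yet to jump, sit in U or at the sink. One at an active site or at the
    sink jumps at no cost; if there is none, all of B sits at sites still unvisited, and the chain
    jumps instead. *)
Lemma defect_reach pot : is_potential Q pot -> forall n sigma (U : {set V}) B p, uniq B ->
  (forall u, u \in B -> if p u is Some v then v \in U else true) ->
  n%:R * (`|defect sigma B p| - reach Q lambda unvisited_end n sigma U)
    <= (1 + lambda) * energy pot sigma.
Proof.
move=> hpot; have pot0 s := energy_ge0 s hpot.
have l0 := ltW (lambda1_gt0 hlambda).
elim=> [|n IHn] sigma U B p uB BU; first by rewrite mul0r mulr_ge0.
(* Inner induction on the number of particles yet to jump; n is lowered only when the chain itself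
   jumps. *)
have [k Bk] := ubnP (size B); elim: k => // k IHk in B p uB BU Bk *.
set rho := reach _ _ _ _ _ _.
have nonpos d : d <= 0 -> n.+1%:R * d <= (1 + lambda) * energy pot sigma.
  by move=> d0; apply: (@le_trans _ _ 0); rewrite ?mulr_ge0 // mulr_ge0_le0.
have [/hasP[u uB' au]|/hasPn inact] :=
    boolP (has (fun u => if p u is Some v then active sigma v else true) B).
  have H := defect_jump uB uB' au.
  apply: (@le_trans _ _ (\sum_x Q (p u) x *
      (n.+1%:R * (`|defect sigma (rem u B) (move p u x)| - rho)))).
    under eq_bigr do rewrite mulrCA mulrBr.
    rewrite -mulr_sumr sumrB -mulr_suml base_chain_sum // mul1r.
    by rewrite ler_wpM2l // lerB.
  have -> : (1 + lambda) * energy pot sigma =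
      \sum_x Q (p u) x * ((1 + lambda) * energy pot sigma).
    by rewrite -mulr_suml base_chain_sum // mul1r.
  apply: ler_sum => x _.
  rewrite ler_wpM2l ?base_chain_ge0 //; apply: IHk.
  - exact: rem_uniq.
  - move=> w; rewrite mem_rem_uniq // inE => /andP[wu wB].
    by rewrite ffunE (negbTE wu); exact: BU.
  - rewrite size_rem //; move: Bk; case: (B) uB' => //= ? ? _.
pose U' := [set v in U | ~~ active sigma v]%SET.
have BU' u : u \in B -> if p u is Some v then v \in U' else false.
  move=> uB'; have := BU _ uB'; have := inact _ uB'.
  by case: (p u) => // v av vU; rewrite inE vU.
have [B0|[u uB']] : B = [::] \/ exists u, u \in B.
  by case: (B) => [|u B']; [left | right; exists u; rewrite mem_head].
  by apply: nonpos; rewrite B0 /defect subrr normr0 sub0r oppr_le0 reach_ge0.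
have U'0 : U' != finset.set0.
  have := BU' _ uB'; case: (p u) => // v vU'.
  by apply/set0Pn; exists v.
have [st|unst] := boolP (stable sigma).
  (* Activity has ended with an unvisited site, so [reach] is 1 and absorbs the defect. *)
  apply: nonpos; rewrite subr_le0 /rho reach_stable // /unvisited_end st.
  suff -> : U != finset.set0 by exact: defect_le1.
  apply: contraNneq U'0 => U0; rewrite -finset.subset0 -U0.
  by apply/fintype.subsetP => v; rewrite inE => /andP[].
apply: (@mean_descent _ _ Q hQ _ hlambda pot sigma n _
  (fun t => `|defect t B p| - reach Q lambda unvisited_end n t U') hpot unst) => [||t].
- have := reach_ge0 hQ hlambda unvisited_end n.+1 sigma U.
  by rewrite -/rho; have := defect_le1 sigma B p; lra.
- rewrite meanB lerD2r -(mean_invariant hQ hlambda sigma (@invariant_defect B p)).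
  exact: ler_norm_mean.
- by apply: IHn => // w wB; have := BU' _ wB; case: (p w).
Qed.

(** With the added particles at [all_home] every site is active, so f takes its value at
    [full_config]; with all of them sunk, sigma alone is left. In between, [escape_bound] charges r
    per round. *)
Lemma coupling_bound sigma r n :
  (forall k, reach Q lambda unvisited_end k sigma [set: V]%SET <= r) ->
  `|f full_config - f sigma| <= n%:R * r + escape Q n all_home.
Proof.
move=> Hr; have [pot hpot] := exists_potential hQ.
have defect_r p : `|defect sigma (enum V) p| <= r.
  rewrite -subr_le0.
  apply: (@le0_of_natmul_bounded _ _ ((1 + lambda) * energy pot sigma)) => k.
  apply: le_trans (@defect_reach pot hpot k sigma [set: V]%SET (enum V) p _ _).
  - by rewrite ler_wpM2l // lerD2l lerN2.
  - exact: enum_uniq.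
  - by move=> u _; case: (p u).
have := @escape_bound _ _ Q hQ (fun p => f (join sigma (occupation p)))
  (f sigma) r n all_home defect_r.
have -> : f (join sigma (occupation all_home)) = f full_config.
  apply: (invariant_full hQ hlambda hf f01) => v; rewrite /active !ffunE.
  suff -> : (\sum_u (all_home u == Some v) = 1)%N by rewrite /= addn1.
  rewrite (bigD1 v) //= ffunE eqxx big1 // => u uv.
  by rewrite ffunE (inj_eq (@Some_inj _)) (negbTE uv).
apply=> q; case: eqP => [->|_] /=.
  suff -> : occupation all_sunk = [ffun=> 0%N] by rewrite join0 subrr normr0.
  by apply/ffunP => v; rewrite !ffunE big1 // => u _; rewrite ffunE.
have /andP[b0 b1] := f01 (join sigma (occupation q)); have /andP[a0 a1] := f01 sigma.
by rewrite ler_norml; apply/andP; split; lra.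
Qed.

End Coupling.

(** * Trajectories of the process *)

Section Events.
Context {R : realType} {d : measure_display} {T : measurableType d}.
Context (P : probability T R).
Implicit Types (A B : set T).

Lemma fine_probK A : measurable A -> (fine (P A))%:E = P A.
Proof. by move=> mA; rewrite fineK // fin_num_measure. Qed.

Lemma prob_setI_negligible A B : measurable A -> measurable B ->
  P.-negligible (A `&` ~` B) -> P (A `&` B) = P A.
Proof.
move=> mA mB N; rewrite [RHS](measureDI P mA mB) setDE.
rewrite [X in (X + _)%E](_ : _ = 0%E) ?add0e //.
by apply: measure_negligible => //; apply: measurableI => //; exact: measurableC.
Qed.

Lemma sum_disjoint_le (I : eqType) (l : seq I) (F : I -> set T) A :
  uniq l -> measurable A -> (forall i, measurable (F i)) ->
  (forall i j, i != j -> F i `&` F j = set0) ->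
  (\sum_(i <- l) P (A `&` F i) <= P A)%E.
Proof.
move=> + + mF dF; elim: l A => [|i l IH] A; first by rewrite big_nil.
move=> /= /andP[il ul] mA; rewrite big_cons (measureDI P mA (mF i)) addeC.
have mAi : measurable (A `\` F i) by exact: measurableD.
apply: leeD => //; apply: le_trans (IH _ ul mAi).
rewrite big_seq_cond [leRHS]big_seq_cond; apply: lee_sum => j /andP[jl _].
rewrite le_measure ?inE //; try exact: measurableI.
move=> w [Aw Fjw]; split => //; split => // Fiw.
have ij : i != j by apply: contraNneq il => ->.
by have : (F i `&` F j) w by []; rewrite dF.
Qed.

Lemma negligible_countable (I : countType) (F : I -> set T) :
  (forall i, P.-negligible (F i)) -> P.-negligible (\bigcup_i F i).
Proof.
move=> NF; pose G n := if unpickle n is Some i then F i else set0.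
apply: (@negligibleS _ _ _ _ (\bigcup_n G n)).
  by move=> w [i _ Fiw]; exists (pickle i) => //; rewrite /G pickleK.
apply: negligible_bigcup => n; rewrite /G; case: (unpickle n) => // *.
exact: negligible_set0.
Qed.

End Events.

Lemma sum_lty (R : realType) (h : nat -> \bar R) n : (forall k, (0 <= h k)%E) ->
  (\sum_(k < n) h k < +oo)%E <-> (forall k, (k < n)%N -> (h k < +oo)%E).
Proof.
move=> h0; elim: n => [|n [IH1 IH2]]; first by rewrite big_ord0.
have s0 : (0 <= \sum_(k < n) h k)%E by exact: sume_ge0.
rewrite big_ord_recr /=; split.
  move=> H; have [sf hf] : (\sum_(k < n) h k < +oo)%E /\ (h n < +oo)%E.
    move: s0 (h0 n) H; case: (\sum_(k < n) h k)%E => [x||] //; case: (h n) => [y||] //.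
    by rewrite !ltry.
  move=> k; rewrite ltnS leq_eqVlt => /predU1P[->//|]; exact: IH1.
move=> H; apply: lte_add_pinfty; last exact: H.
by apply: IH2 => k kn; apply: H; rewrite ltnS ltnW.
Qed.

Definition extend (T : Type) (n : nat) (s : nat -> T) (x : T) : nat -> T :=
  fun k => if (k <= n)%N then s k else x.

Section Trajectories.
Context {R : realType} {V : finType} {Q : option V -> option V -> R}.
Context (hQ : base_chain Q) {lambda : R} (hlambda : 0 < lambda).
Context (X : ARW Q lambda) (sigma : config V).
Local Notation P := (arw_prob X sigma).
Local Notation state := (@arw_state _ _ _ _ X).
Local Notation hold := (@arw_hold _ _ _ _ X).
Local Notation exit_rate := (exit_rate Q lambda).
Local Notation jump_prob := (jump_prob Q lambda).
Implicit Types (omega : arw_space X) (s : nat -> config V).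

Definition cylinder n s : set (arw_space X) :=
  [set omega | forall k, (k <= n)%N -> state k omega = s k].

Definition cylinder_prob n s : R :=
  (s 0%N == sigma)%:R * \prod_(k < n) jump_prob (s k) (s k.+1).

(** With all time thresholds 0 the constraints on the positive holding times are void and the
    exponentials equal 1. *)
Lemma prob_cylinder n s : P (cylinder n s) = (cylinder_prob n s)%:E.
Proof.
have := arw_law X sigma n s (fun=> lexx (0 : R)).
rewrite (_ : [set omega | _] = cylinder n s); last first.
  apply/seteqP; split => [omega [] //|omega Cs]; split => // k _.
  exact: arw_hold_gt0.
move=> ->; congr (_ * _)%:E; apply: eq_bigr => k _.
by rewrite mulr0 oppr0 expR0 mul1r.
Qed.

Lemma measurable_cylinder n s : measurable (cylinder n s).
Proof.
rewrite (_ : cylinder n s =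
    \bigcap_(k in [set k | (k <= n)%N]) [set omega | state k omega = s k]).
  by apply: bigcap_measurableType => k _; exact: arw_state_measurable.
by apply/seteqP; split => omega H k; exact: H.
Qed.

Lemma cylinder_extend n s tau :
  cylinder n.+1 (extend n s tau) = cylinder n s `&` [set omega | state n.+1 omega = tau].
Proof.
apply/seteqP; split => omega => [H|[H H1] k].
  split; last by rewrite /= H // /extend ltnn.
  by move=> k kn; rewrite H ?(leqW kn) // /extend kn.
rewrite leq_eqVlt ltnS => /predU1P[->|kn]; first by rewrite /extend ltnn.
by rewrite /extend kn H.
Qed.

Lemma cylinder_prob_recr n s :
  cylinder_prob n.+1 s = cylinder_prob n s * jump_prob (s n) (s n.+1).
Proof. by rewrite /cylinder_prob big_ord_recr /= mulrA. Qed.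

Lemma cylinder_prob_extend n s tau :
  cylinder_prob n.+1 (extend n s tau) = cylinder_prob n s * jump_prob (s n) tau.
Proof.
rewrite cylinder_prob_recr /extend leqnn ltnn; congr (_ * _).
rewrite /cylinder_prob leq0n; congr (_ * _); apply: eq_bigr => k _.
by rewrite (ltn_ord k) (ltnW (ltn_ord k)).
Qed.

(** There are countably many configurations, hence countably many cylinders of a given length. *)
Lemma negligible_cylinders (B : set (arw_space X)) n :
  (forall s, P.-negligible (cylinder n s `&` B)) -> P.-negligible B.
Proof.
move=> NB; apply: (@negligibleS _ _ _ _
    (\bigcup_(t : n.+1.-tuple (config V)) (cylinder n (fun k => nth sigma t k) `&` B))).
  move=> omega Bw; exists [tuple state k omega | k < n.+1] => //; split=> // k kn.
  by rewrite (nth_mktuple _ _ (Ordinal (kn : (k < n.+1)%N))).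
exact: negligible_countable.
Qed.

Lemma negligible_leave_stable :
  P.-negligible [set omega | exists n, stable (state n omega) /\
                                       state n.+1 omega <> state n omega].
Proof.
apply: (@negligibleS _ _ _ _ (\bigcup_n [set omega | stable (state n omega) /\
                                       state n.+1 omega <> state n omega])).
  by move=> omega [n Hn]; exists n.
apply: negligible_bigcup => n; apply: (@negligible_cylinders _ n.+1) => s.
have [[st ne]|Hs] := pselect (stable (s n) /\ s n.+1 <> s n).
  apply: (@negligibleS _ _ _ _ (cylinder n.+1 s)); first by move=> ? [].
  apply/negligibleP; first exact: measurable_cylinder.
  apply: etrans (prob_cylinder _ _) _; rewrite cylinder_prob_recr jump_prob_stable //.
  by case: eqP => // _; rewrite mulr0.
apply: (@negligibleS _ _ _ _ set0); last exact: negligible_set0.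
by move=> omega [Cw [st ne]]; apply: Hs; rewrite -!Cw.
Qed.

(** All thresholds but the one at n are 0; the state [n.+1] is fixed as well because the law
    prescribes a holding time only together with the next state. *)
Lemma prob_long_hold n s (j : nat) :
  (P (cylinder n.+1 s `&` [set omega | j%:R%:E < hold n omega])
     <= (expR (- (exit_rate (s n) * j%:R)))%:E)%E.
Proof.
pose t k : R := if k == n then j%:R else 0.
have t0 k : 0 <= t k by rewrite /t; case: ifP.
have := arw_law X sigma n.+1 s t0.
rewrite (_ : [set omega | _] = cylinder n.+1 s `&` [set omega | (j%:R%:E < hold n omega)%E]).
  move=> ->; rewrite lee_fin big_ord_recr /= {2}/t eqxx.
  set E := expR _; set p := \prod_(k < n) _.
  have E0 : 0 <= E by exact: expR_ge0.
  have p01 : 0 <= p <= 1.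
    apply/andP; split.
      by apply: prodr_ge0 => k _; rewrite mulr_ge0 ?expR_ge0 ?jump_prob_ge0.
    apply: prodr_ile1 => k _; rewrite mulr_ge0 ?expR_ge0 ?jump_prob_ge0 //=.
    rewrite mulr_ile1 ?expR_ge0 ?jump_prob_ge0 ?jump_prob_le1 //.
    by rewrite expR_le1 oppr_le0 mulr_ge0 ?rate_ge0.
  have /andP[p0 p1] := p01; have j1 := jump_prob_le1 hQ hlambda (s n) (s n.+1).
  have j0 := jump_prob_ge0 hQ hlambda (s n) (s n.+1).
  have e1 : (s 0%N == sigma)%:R <= 1 :> R by case: (_ == _).
  rewrite -[leRHS]mul1r; apply: ler_pM; rewrite ?mulr_ge0 //.
  rewrite -[leRHS]mul1r; apply: ler_pM; rewrite ?mulr_ge0 //.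
  by rewrite ler_piMr.
apply/seteqP; split => omega [Cw Hw]; split => //=.
  by have := Hw n (ltnSn n); rewrite /t eqxx.
move=> k kn; rewrite /t; case: eqP => [->//|_]; exact: arw_hold_gt0.
Qed.

(** The exit rate of an unstable configuration is positive, so its holding time has an exponential
    tail; by [expR y >= 1 + y], j times the probability of an infinite one stays bounded in j. *)
Lemma negligible_infinite_hold :
  P.-negligible [set omega | exists n, ~~ stable (state n omega) /\ hold n omega = +oo%E].
Proof.
apply: (@negligibleS _ _ _ _ (\bigcup_n [set omega |
    ~~ stable (state n omega) /\ hold n omega = +oo%E])).
  by move=> omega [n Hn]; exists n.
apply: negligible_bigcup => n; apply: (@negligible_cylinders _ n.+1) => s.
have [st|unst] := boolP (stable (s n)).
  apply: (@negligibleS _ _ _ _ set0); last exact: negligible_set0.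
  by move=> omega [Cw [+ _]]; rewrite Cw // st.
have [pot hpot] := exists_potential hQ.
have [q0 _] := mean_le_energy hQ hlambda hpot unst.
pose B := cylinder n.+1 s `&` [set omega | hold n omega = +oo%E].
have mhold (Y : set (\bar R)) : measurable Y -> measurable [set omega | Y (hold n omega)].
  by move=> mY; rewrite -[X in measurable X]setTI; exact: arw_hold_measurable.
have mB : measurable B.
  by apply: measurableI; [exact: measurable_cylinder | apply: (mhold [set +oo%E])].
apply: (@negligibleS _ _ _ _ B); first by move=> omega [Cw []].
apply/negligibleP => //; apply: etrans (esym (fine_probK P mB)) _; congr (_%:E).
set x := fine _.
have x0 : 0 <= x by rewrite fine_ge0.
apply/eqP; rewrite eq_le x0 andbT -(pmulr_rle0 _ q0).
apply: (@le0_of_natmul_bounded _ _ 1) => j.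
have xE : x <= expR (- (exit_rate (s n) * j%:R)).
  rewrite -lee_fin /x fine_probK //; apply: le_trans (prob_long_hold n s j).
  rewrite le_measure ?inE //.
    apply: measurableI; first exact: measurable_cylinder.
    apply: (mhold [set y | (j%:R%:E < y)%E]).
    by rewrite -set_interval.set_itvoy; exact: emeasurable_itv.
  by move=> omega [Cw /= ->]; split => //; rewrite ltry.
have := expR_ge1Dx (exit_rate (s n) * j%:R); set y := exit_rate _ * _ in xE *.
have : x * expR y <= 1.
  by rewrite -ler_pdivlMr ?expR_gt0 // mul1r -expRN.
have -> : j%:R * (exit_rate (s n) * x) = x * y by rewrite /y; ring.
move=> H1 H2; apply: le_trans H1; rewrite ler_wpM2l //; lra.
Qed.

(** Off this null set, stable states are absorbing and unstable ones have finite holding times. *)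
Definition exceptional : set (arw_space X) :=
  [set omega | exists n, stable (state n omega) /\ state n.+1 omega <> state n omega] `|`
  [set omega | exists n, ~~ stable (state n omega) /\ hold n omega = +oo%E].

Lemma negligible_exceptional : P.-negligible exceptional.
Proof. exact: negligibleU negligible_leave_stable negligible_infinite_hold. Qed.

Lemma state_absorbed omega n k : ~ exceptional omega -> stable (state n omega) ->
  (n <= k)%N -> state k omega = state n omega.
Proof.
move=> good st; elim: k => [|k IH]; first by rewrite leqn0 => /eqP ->.
rewrite leq_eqVlt => /predU1P[->//|]; rewrite ltnS => nk.
apply: contrapT => ne; apply: good; left; exists k; rewrite IH // ; split=> //.
Qed.

Lemma at_timeE omega tau : (exists t, at_time t omega tau) <->
  exists n, state n omega = tau /\ forall k, (k < n)%N -> (hold k omega < +oo)%E.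
Proof.
have h0 k : (0 <= hold k omega)%E by rewrite ltW // arw_hold_gt0.
split=> [[t [n [sn tn _]]]|[n [sn hn]]].
  exists n; split => //; apply/(sum_lty _ h0).
  by apply: le_lt_trans tn _; rewrite ltry.
have s_lty : (\sum_(k < n) hold k omega < +oo)%E by exact/(sum_lty _ h0).
have s_fin : (\sum_(k < n) hold k omega)%E \is a fin_num.
  by rewrite ge0_fin_numE // sume_ge0.
exists (fine (\sum_(k < n) hold k omega)%E), n; split => //; rewrite fineK //.
by rewrite big_ord_recr /= lteDl // arw_hold_gt0.
Qed.

Lemma measurable_state_pred n (A : config V -> Prop) :
  measurable [set omega | A (state n omega)].
Proof.
rewrite (_ : [set omega | _] =
    \bigcup_(tau : config V) [set omega | A tau /\ state n omega = tau]).
  apply: countable_bigcupT_measurable => [|tau]; first exact: countableP.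
  have [At|NAt] := pselect (A tau).
    rewrite (_ : [set omega | _] = [set omega | state n omega = tau]).
      exact: arw_state_measurable.
    by apply/seteqP; split => [omega []|omega].
  rewrite (_ : [set omega | _] = set0) //.
  by apply/seteqP; split => [omega []|omega].
apply/seteqP; split => [omega Aw|omega [tau _ [At sn]]].
  by exists (state n omega).
by rewrite /= sn.
Qed.

Lemma measurable_reached (A : config V -> Prop) :
  measurable [set omega | exists n, A (state n omega) /\
                            forall k, (k < n)%N -> (hold k omega < +oo)%E].
Proof.
rewrite (_ : [set omega | _] = \bigcup_n ([set omega | A (state n omega)] `&`
   \bigcap_(k in [set k | (k < n)%N]) [set omega | (hold k omega < +oo)%E])).
  apply: bigcupT_measurable => n; apply: measurableI; first exact: measurable_state_pred.
  apply: bigcap_measurableType => k _; rewrite -[X in measurable X]setTI.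
  have := @arw_hold_measurable _ _ _ _ X k measurableT [set y | (y < +oo)%E].
  by apply; rewrite -set_interval.set_itvNyo; exact: emeasurable_itv.
by apply/seteqP; split => [omega [n [An hn]]|omega [n _ [An hn]]]; exists n.
Qed.

Lemma stabilizes_toE xi : stabilizes_to (X := X) xi =
  [set omega | exists n, state n omega = to_config xi /\
                 forall k, (k < n)%N -> (hold k omega < +oo)%E].
Proof. by apply/seteqP; split => omega /at_timeE. Qed.

Lemma measurable_stabilizes_to xi : measurable (stabilizes_to (X := X) xi).
Proof.
rewrite stabilizes_toE; exact: (measurable_reached (fun tau => tau = to_config xi)).
Qed.

Lemma visits_allE : visits_all X =
  \bigcap_(v in [set: V]) [set omega | exists n, active (state n omega) v /\
                 forall k, (k < n)%N -> (hold k omega < +oo)%E].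
Proof.
apply/seteqP; split => omega H v; first move=> _.
  have [t [tau [Ht av]]] := H v.
  have /at_timeE[n [sn hn]] : exists t, at_time t omega tau by exists t.
  by exists n; rewrite sn.
have [n [an hn]] := H v I.
have /at_timeE[t Ht] : exists n0, state n0 omega = state n omega /\
    forall k, (k < n0)%N -> (hold k omega < +oo)%E by exists n.
by exists t, (state n omega).
Qed.

Lemma measurable_visits_all : measurable (visits_all X).
Proof.
rewrite visits_allE; apply: fin_bigcap_measurable => // v _.
exact: (measurable_reached (fun tau => active tau v)).
Qed.

Definition unvisited n s : {set V} := [set v | [forall k : 'I_n, ~~ active (s k) v]]%SET.

Lemma unvisited_recr n s :
  [set v in unvisited n s | ~~ active (s n) v]%SET = unvisited n.+1 s.
Proof.
apply/setP => v; rewrite !inE; apply/andP/forallP => [[/forallP H Hn] k|H].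
  by case: (unliftP ord_max k) => [j ->|->] //; rewrite lift_max; exact: H.
split; last exact: (H ord_max).
by apply/forallP => k; have := H (widen_ord (leqnSn n) k).
Qed.

Lemma unvisited_extend n s tau : unvisited n.+1 (extend n s tau) = unvisited n.+1 s.
Proof.
by apply/setP => v; rewrite !inE; apply: eq_forallb => k; rewrite /extend -ltnS ltn_ord.
Qed.

(** A is an event that the test T implies almost surely. Induction on the jumps left splits a
    cylinder over the next state; for an inequality, states outside [successors] can be ignored. *)
Lemma reach_le_prob (T : config V -> {set V} -> bool) (A : set (arw_space X)) :
  measurable A ->
  (forall n s, T (s n) (unvisited n.+1 s) -> P.-negligible (cylinder n s `&` ~` A)) ->
  forall j, reach Q lambda T j sigma [set: V]%SET <= fine (P A).
Proof.
move=> mA HT j.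
have gen i n s : ((cylinder_prob n s * reach Q lambda T i (s n) (unvisited n s))%:E
    <= P (cylinder n s `&` A))%E.
  elim: i n s => [|i IH] n s /=; rewrite unvisited_recr.
    have [/HT N|_] := boolP (T (s n) (unvisited n.+1 s)); last by rewrite mulr0.
    by rewrite mulr1 -prob_cylinder (prob_setI_negligible (measurable_cylinder n s) mA N).
  rewrite /mean mulr_sumr -sumEFin.
  have mC := measurable_cylinder n s.
  apply: le_trans (@sum_disjoint_le _ _ _ P _ (successors (s n))
    (fun tau => [set omega | state n.+1 omega = tau]) _ (undup_uniq _)
    (measurableI _ _ mC mA) _ _).
  - apply: lee_sum => tau _; rewrite setIAC -cylinder_extend mulrA -cylinder_prob_extend.
    have := IH n.+1 (extend n s tau).
    by rewrite unvisited_extend {2}/extend ltnn.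
  - by move=> tau; exact: arw_state_measurable.
  - by move=> tau tau' ne; apply/seteqP; split => // omega [/= -> /eqP]; rewrite (negbTE ne).
have := gen j 0%N (fun=> sigma).
rewrite /cylinder_prob eqxx big_ord0 mulr1 mul1r -lee_fin fine_probK //.
have -> : unvisited 0 (fun=> sigma) = [set: V]%SET.
  by apply/setP => v; rewrite !inE; apply/forallP => -[].
move=> H; apply: le_trans H _; rewrite le_measure ?inE //.
by apply: measurableI => //; exact: measurable_cylinder.
Qed.

Lemma reach_le_stab_law xi j :
  reach Q lambda (fun tau _ => tau == to_config xi) j sigma [set: V]%SET
  <= stab_law X sigma xi.
Proof.
apply: reach_le_prob; first exact: measurable_stabilizes_to.
move=> n s /eqP sn; apply: negligibleS negligible_exceptional => omega [Cw Nst].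
apply: contrapT => good; apply: Nst; rewrite stabilizes_toE.
(* The index n may come after absorption, behind an infinite holding time; the first stable index
   does not. *)
have ex_st : exists k, stable (state k omega).
  by exists n; rewrite Cw // sn stable_to_config.
have st_m := ex_minnP ex_st; case: st_m => m st_m min_m.
exists m; split.
  rewrite -(state_absorbed good st_m (min_m n _)) ?Cw //.
  by rewrite sn stable_to_config.
move=> k km; rewrite ltey; apply/eqP => hk; apply: good; right; exists k; split => //.
by apply: contraTN km => /min_m; rewrite leqNgt.
Qed.

(** A trajectory stable at n almost surely stays there, so a site not active up to n is never
    visited. *)
Lemma reach_le_not_visits j :
  reach Q lambda (@unvisited_end V) j sigma [set: V]%SET <= fine (P (~` visits_all X)).
Proof.
apply: reach_le_prob; first exact: measurableC measurable_visits_all.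
move=> n s /andP[st /set0Pn[v]]; rewrite inE => /forallP unv.
apply: negligibleS negligible_exceptional => omega [Cw]; rewrite setCK visits_allE.
move=> /(_ v I)[k [ak _]]; apply: contrapT => good.
have [kn|nk] := leqP k n.
  by have := unv (Ordinal (kn : (k < n.+1)%N)); rewrite /= -Cw // ak.
have st' : stable (state n omega) by rewrite Cw.
by move: ak; rewrite (state_absorbed good st' (ltnW nk)); apply/negP; exact: (forallP st').
Qed.

(** Off the exceptional null set a trajectory has at most one stable state, so the events become
    disjoint once that set is removed. *)
Lemma sum_stab_law_le1 : \sum_xi stab_law X sigma xi <= 1.
Proof.
have [N [mN N0 subN]] := negligible_exceptional.
have mS xi : measurable (stabilizes_to (X := X) xi `\` N).
  by apply: measurableD => //; exact: measurable_stabilizes_to.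
have -> : \sum_xi stab_law X sigma xi =
    fine (\sum_(xi <- index_enum {: sconfig V})
      P (setT `&` (stabilizes_to (X := X) xi `\` N)))%E.
  rewrite -sum_fine => [|xi _]; last by rewrite setTI fin_num_measure.
  apply: eq_bigr => xi _; rewrite /stab_law setTI setDE prob_setI_negligible //.
  - exact: measurable_stabilizes_to.
  - exact: measurableC.
  - rewrite setCK; apply: (@negligibleS _ _ _ _ N); first by move=> ? [].
    exact/negligibleP.
rewrite -lee_fin -(probability_setT P) -[leRHS]fine_probK // lee_fin fine_le //.
- rewrite sum_fin_num; apply/allP => _ /mapP[xi _ ->].
  by rewrite /= setTI fin_num_measure.
- by rewrite fin_num_measure.
apply: sum_disjoint_le => //; first exact: index_enum_uniq.
move=> xi xi' ne; apply/seteqP; split => // omega [[S1 Nw] [S2 _]].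
have good : ~ exceptional omega by move=> /subN.
move: S1 S2; rewrite !stabilizes_toE => -[k [sk _]] [l [sl _]].
suff /to_config_inj E : to_config xi = to_config xi' by rewrite E eqxx in ne.
have stk : stable (state k omega) by rewrite sk stable_to_config.
have stl : stable (state l omega) by rewrite sl stable_to_config.
have [kl|/ltnW lk] := leqP k l.
  by rewrite -sl (state_absorbed good stk kl).
by rewrite -sk (state_absorbed good stl lk).
Qed.

(** The first mass function is pointwise at least the second, which has mass 1, while its own mass
    is at most 1; so they coincide. *)
Lemma stab_lawE a xi : stab_family Q lambda a -> stab_law X sigma xi = a xi sigma.
Proof.
move=> ha.
have le_a eta : a eta sigma <= stab_law X sigma eta.
  exact: (stab_family_le_reach hQ hlambda ha (reach_le_stab_law eta)).
have := sum_stab_law_le1; rewrite -(stab_family_sum hQ hlambda ha sigma).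
rewrite (bigD1 xi) //= [leRHS](bigD1 xi) //= => H.
have : \sum_(i | i != xi) a i sigma <= \sum_(i | i != xi) stab_law X sigma i.
  by apply: ler_sum => eta _.
by have := le_a xi => H1 H2; apply/eqP; rewrite eq_le H1 andbT; lra.
Qed.

End Trajectories.

(** * Independent walks and stationarity *)

Section Walks.
Context {R : realType} {V : finType} {Q : option V -> option V -> R}.
Context (hQ : base_chain Q) (W : walks Q).
Local Notation P := (walks_prob W).
Local Notation pos := (@walks_pos _ _ _ W).
Implicit Types (omega : walks_space W) (w : nat -> {ffun V -> option V}).

Definition walks_cylinder n w : set (walks_space W) :=
  [set omega | forall k, (k <= n)%N -> forall v, pos k v omega = w k v].

Definition walks_cylinder_prob n w : R :=
  \prod_(v : V) ((w 0%N v == Some v)%:R * \prod_(k < n) Q (w k v) (w k.+1 v)).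

Lemma prob_walks_cylinder n w : P (walks_cylinder n w) = (walks_cylinder_prob n w)%:E.
Proof. exact: (walks_law W n (fun k v => w k v)). Qed.

Lemma measurable_positions n (p : {ffun V -> option V}) :
  measurable [set omega | forall v, pos n v omega = p v].
Proof.
rewrite (_ : [set omega | _] = \bigcap_(v in [set: V]) [set omega | pos n v omega = p v]).
  by apply: fin_bigcap_measurable => // v _; exact: walks_measurable.
by apply/seteqP; split => omega H v; [move=> _|]; exact: H.
Qed.

Lemma measurable_walks_cylinder n w : measurable (walks_cylinder n w).
Proof.
rewrite (_ : walks_cylinder n w = \bigcap_(k in [set k | (k <= n)%N])
    [set omega | forall v, pos k v omega = w k v]).
  by apply: bigcap_measurableType => k _; exact: measurable_positions.
by apply/seteqP; split => omega H k; exact: H.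
Qed.

Lemma walks_cylinder_extend n w p : walks_cylinder n.+1 (extend n w p) =
  walks_cylinder n w `&` [set omega | forall v, pos n.+1 v omega = p v].
Proof.
apply/seteqP; split => omega => [H|[H H1] k].
  split => [k kn v|v]; first by rewrite H ?(leqW kn) // /extend kn.
  by rewrite /= H // /extend ltnn.
rewrite leq_eqVlt ltnS => /predU1P[->|kn] v; first by rewrite /extend ltnn.
by rewrite /extend kn H.
Qed.

Lemma walks_cylinder_prob_extend n w p : walks_cylinder_prob n.+1 (extend n w p) =
  walks_cylinder_prob n w * \prod_v Q (w n v) (p v).
Proof.
rewrite /walks_cylinder_prob -big_split /=; apply: eq_bigr => v _.
rewrite big_ord_recr /= mulrA /extend leqnn ltnn leq0n; congr (_ * _ * _).
by apply: eq_bigr => k _; rewrite (ltn_ord k) (ltnW (ltn_ord k)).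
Qed.

Lemma hitting_time_geE m : [set omega : walks_space W | (m%:R%:E <= hitting_time omega)%E] =
  \bigcap_(k in [set k | (k < m)%N])
    ~` [set omega : walks_space W | forall v, pos k v omega = all_sunk v].
Proof.
apply/seteqP; split => omega /= H.
  move=> k /= km sunk; have : (hitting_time omega <= k%:R%:E)%E.
    apply: ereal_inf_lbound; exists k => //= v.
    by rewrite sunk ffunE.
  by move/(le_trans H); rewrite lee_fin ler_nat leqNgt km.
apply/ereal_infP => _ [k /= sunk <-]; rewrite lee_fin ler_nat leqNgt.
by apply/negP => km; apply: (H k km) => v; rewrite ffunE.
Qed.

Lemma measurable_hitting_time_ge m :
  measurable [set omega : walks_space W | (m%:R%:E <= hitting_time omega)%E].
Proof.
rewrite hitting_time_geE; apply: bigcap_measurableType => k _.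
exact/measurableC/measurable_positions.
Qed.

(** The event says that the walks are not all at the sink at any of the times 0, ..., m - 1, whence
    [m.-1] steps. Trajectories are followed only while some walk is off the sink; the others
    contribute 0 by [escape_sunk]. *)
Lemma escape_le_hitting_time m : (0 < m)%N ->
  escape Q m.-1 all_home <=
    fine (P [set omega : walks_space W | (m%:R%:E <= hitting_time omega)%E]).
Proof.
move=> m0; pose late n := [set omega : walks_space W | (n%:R%:E <= hitting_time omega)%E].
have mL n : measurable (late n) by exact: measurable_hitting_time_ge.
have gen j n w : (forall k, (k <= n)%N -> w k != all_sunk) ->
    ((walks_cylinder_prob n w * escape Q j (w n))%:E
      <= P (walks_cylinder n w `&` late (n + j).+1))%E.
  elim: j n w => [|j IH] n w alive.
    rewrite /escape /= alive // mulr1 addn0 -prob_walks_cylinder.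
    rewrite le_measure ?inE //; first exact: measurable_walks_cylinder.
      by apply: measurableI => //; exact: measurable_walks_cylinder.
    move=> omega Cw; split => //; rewrite /late hitting_time_geE => k kn sunk.
    case/eqP: (alive _ kn); apply/ffunP => v.
    by rewrite -sunk; exact/esym/Cw.
  rewrite escapeS mulr_sumr -sumEFin.
  have mCL := measurableI _ _ (measurable_walks_cylinder n w) (mL (n + j.+1).+1).
  apply: le_trans (@sum_disjoint_le _ _ _ P _ (index_enum {ffun V -> option V})
    (fun p => [set omega | forall v, pos n.+1 v omega = p v]) _
    (index_enum_uniq _) mCL _ _).
  - apply: lee_sum => p _; rewrite setIAC -walks_cylinder_extend mulrA.
    rewrite -walks_cylinder_prob_extend.
    have [->|pN] := eqVneq p all_sunk; first by rewrite escape_sunk // mulr0.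
    have ext_p : extend n w p n.+1 = p by rewrite /extend ltnn.
    have := IH n.+1 (extend n w p); rewrite ext_p addSnnS; apply.
    by move=> k kn; rewrite /extend; case: ifP => // /alive.
  - by move=> p; exact: measurable_positions.
  - move=> p q pq; apply/seteqP; split => // omega [/= Hp Hq].
    by case/eqP: pq; apply/ffunP => v; rewrite -Hp Hq.
(* This equality holds only when V is empty. *)
have [home|home] := eqVneq (@all_home V) all_sunk.
  by rewrite home escape_sunk // fine_ge0.
have := gen m.-1 0%N (fun=> all_home) (fun _ _ => home).
rewrite /walks_cylinder_prob big1 ?mul1r => [|v _]; last first.
  by rewrite ffunE eqxx big_ord0 mulr1.
rewrite add0n prednK // -lee_fin (fine_probK _ (mL m)) => H; apply: le_trans H _.
rewrite le_measure ?inE //.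
by apply: measurableI => //; exact: measurable_walks_cylinder.
Qed.

End Walks.

(** * Identification of the stationary distribution *)

Section Stationarity.
Context {R : realType} {V : finType} {Q : option V -> option V -> R}.
Context (hQ : base_chain Q) {lambda : R} (hlambda : 0 < lambda).
Context (X : ARW Q lambda) (u : driving R V) (pi : sconfig V -> R).
Context (hpi : stationary_distribution X u pi).
Context (a : sconfig V -> config V -> R) (ha : stab_family Q lambda a).

(** By [stab_family_join], stabilizing after each addition has the same effect as adding all driving
    particles first and stabilizing once. *)
Lemma foldl_driven_step nu us xi : foldl (driven_step X) nu us xi =
  \sum_eta nu eta * a xi (join (to_config eta) (counts us)).
Proof.
elim: us nu => [|v us IH] nu.
  rewrite (bigD1 xi) //= big1 => [|eta ne]; last first.
    rewrite (_ : counts _ = [ffun=> 0%N]); last by apply/ffunP => v; rewrite !ffunE.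
    by rewrite join0 (stab_family_stable ha) (negbTE ne) mulr0.
  rewrite (_ : counts _ = [ffun=> 0%N]); last by apply/ffunP => v; rewrite !ffunE.
  by rewrite join0 (stab_family_stable ha) eqxx mulr1 addr0.
rewrite /= IH; under [LHS]eq_bigr do rewrite /driven_step mulr_suml.
rewrite exchange_big /=; apply: eq_bigr => eta _.
under [LHS]eq_bigr do rewrite -mulrA (stab_lawE hQ hlambda _ _ _ ha).
rewrite -mulr_sumr -(stab_family_join hQ hlambda ha) add_active_join join_joinE.
congr (_ * a _ (join _ _)); apply/ffunP => w; rewrite !ffunE /=.
by rewrite [v == w]eq_sym.
Qed.

Definition driving_weight t (us : t.-tuple V) : R := fine (driving_prob u
  [set omega : driving_space u | forall i : 'I_t, driving_vertex i omega = tnth us i]).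

Lemma stationary_average (A : {set sconfig V}) t : \sum_(xi in A) pi xi =
  \sum_(us : t.-tuple V) \sum_eta
    driving_weight us * pi eta * stab_set a A (join (to_config eta) (counts us)).
Proof.
have [_ _ pi_step] := hpi.
under eq_bigr do rewrite -(pi_step t) /driven_law.
rewrite exchange_big /=; apply: eq_bigr => us _.
rewrite -mulr_sumr -/(driving_weight us).
under [X in _ * X = _]eq_bigr do rewrite foldl_driven_step.
rewrite exchange_big mulr_sumr /=; apply: eq_bigr => eta _.
by rewrite -mulrA -mulr_sumr.
Qed.

(** The left side averages, over driving sequences and initial states, values that [crowd_limit]
    puts within e of the right side, for every positive e. *)
Lemma stationary_full (A : {set sconfig V}) :
  \sum_(xi in A) pi xi = stab_set a A full_config.
Proof.
have [pi0 pi1 pi_step] := hpi; set c := stab_set a A full_config.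
have invf := @invariant_stab_set _ _ Q lambda a ha A.
have f01 s : 0 <= stab_set a A s <= 1.
  by rewrite (stab_set_ge0 ha) (stab_set_le1 hQ hlambda ha).
suff H e : 0 < e -> `|\sum_(xi in A) pi xi - c| <= e.
  apply/eqP; rewrite -subr_eq0 -normr_le0; apply/ler_addgt0Pl => e e0.
  by rewrite addr0; exact: H.
move=> e0; have [t ht] := crowd_limit hQ hlambda invf f01 e0.
have pu0 us : 0 <= driving_weight us :> R by rewrite fine_ge0.
rewrite (stationary_average A t).
(* The total weight is read off from stationarity itself, with A the whole space. *)
have weight1 : \sum_(us : t.-tuple V) \sum_eta driving_weight us * pi eta = 1.
  have := stationary_average [set: sconfig V]%SET t.
  rewrite (eq_bigl xpredT) => [|xi]; last by rewrite inE.
  rewrite pi1 => ->; apply: eq_bigr => us _; apply: eq_bigr => eta _.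
  rewrite /stab_set (eq_bigl xpredT) => [|xi]; last by rewrite inE.
  by rewrite (stab_family_sum hQ hlambda ha) mulr1.
have -> : c = \sum_(us : t.-tuple V) \sum_eta driving_weight us * pi eta * c.
  by rewrite -[LHS]mul1r -weight1 mulr_suml; apply: eq_bigr => us _; rewrite mulr_suml.
have -> : e = \sum_(us : t.-tuple V) \sum_eta driving_weight us * pi eta * e.
  by rewrite -[LHS]mul1r -weight1 mulr_suml; apply: eq_bigr => us _; rewrite mulr_suml.
rewrite -sumrB; apply: le_trans (ler_norm_sum _ _ _) _; apply: ler_sum => us _.
rewrite -sumrB; apply: le_trans (ler_norm_sum _ _ _) _; apply: ler_sum => eta _.
rewrite -mulrBr normrM ger0_norm ?mulr_ge0 // ler_wpM2l ?mulr_ge0 //.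
by apply: ht; rewrite size_tuple.
Qed.

End Stationarity.

Theorem theorem1p2 (R : realType) (V : finType)
    (Q : option V -> option V -> R) (hQ : base_chain Q)
    (lambda : R) (hlambda : 0 < lambda)
    (X : ARW Q lambda) (W : walks Q)
    (u : driving R V) (pi : sconfig V -> R)
    (hpi : stationary_distribution X u pi)
    (sigma : config V) (m : nat) (hm : (1 <= m)%N) :
  ((tv_dist (stab_law X sigma) pi)%:E <=
    m%:R%:E * arw_prob X sigma (~` visits_all X)
    + walks_prob W [set omega | (m%:R%:E <= hitting_time omega)%E])%E.
Proof.
have [a ha] := exists_stab_family hQ hlambda.
have mV : measurable (~` visits_all X) by exact/measurableC/measurable_visits_all.
rewrite -(fine_probK _ mV) -(fine_probK _ (measurable_hitting_time_ge W m)).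
rewrite -EFinM -EFinD lee_fin.
set r := fine (arw_prob X sigma _); set h := fine (walks_prob W _).
have r0 : 0 <= r by rewrite fine_ge0.
apply: ge_sup; first by eexists; exists finset.set0.
move=> _ [A _ <-].
have -> : \sum_(x in A) stab_law X sigma x = stab_set a A sigma.
  by apply: eq_bigr => xi _; rewrite (stab_lawE hQ hlambda _ _ _ ha).
rewrite (stationary_full hQ hlambda hpi ha) distrC.
have f01 s : 0 <= stab_set a A s <= 1.
  by rewrite (stab_set_ge0 ha) (stab_set_le1 hQ hlambda ha).
(* After m - 1 rounds, walks not yet all sunk have hitting time at least m; the factor m - 1 is then
   enlarged to m. *)
apply: le_trans (coupling_bound hQ hlambda (invariant_stab_set ha A) f01 m.-1
  (reach_le_not_visits hQ hlambda X sigma)) _.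
apply: lerD; first by rewrite ler_wpM2r // ler_nat leq_pred.
exact: escape_le_hitting_time.
Qed.
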